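(* Let $R$ be a commutative Noetherian henselian local ring and let $\mathcal C$ be a subcategory of $\mathrm{mod}\,R$. Suppose that: (1) $\mathcal C$ is a resolving subcategory of $\mathrm{mod}\,R$; (2) $\mathrm{mod}\,\underline{\mathcal C}$ is a Frobenius category; (3) there is no nonprojective module $X\in\mathcal C$ with $\mathrm{Ext}^1_R(-,X)|_{\underline{\mathcal C}}=0$. Then $\mathcal C\subseteq\mathcal G$.
   Context: $\mathrm{mod}\,R$ is the category of finitely generated $R$-modules. A *subcategory* of $\mathrm{mod}\,R$ always means a full subcategory closed under isomorphism, such that for all $X,Y\in\mathrm{mod}\,R$ one has $X\oplus Y\in\mathcal C$ if and only if $X\in\mathcal C$ and $Y\in\mathcal C$, and which contains all projective modules in $\mathrm{mod}\,R$. $\mathcal C$ is *resolving* if for every exact sequence $0\to X\to Y\to Z\to 0$ in $\mathrm{mod}\,R$: $X,Z\in\mathcal C$ implies $Y\in\mathcal C$, and $Y,Z\in\mathcal C$ implies $X\in\mathcal C$. The transpose $\mathrm{Tr}\,X$ of $X\in\mathrm{mod}\,R$ is the cokernel of $\mathrm{Hom}_R(P_0,R)\to\mathrm{Hom}_R(P_1,R)$, where $P_1\to P_0\to X\to 0$ is a presentation by finitely generated projective modules (unique up to projective summands). $\mathcal G$ is the subcategory of all $X\in\mathrm{mod}\,R$ with $\mathrm{Ext}^i_R(X,R)=0$ and $\mathrm{Ext}^i_R(\mathrm{Tr}\,X,R)=0$ for all $i>0$. The stable category $\underline{\mathcal C}$ has the same objects as $\mathcal C$, and its morphism sets are $\underline{\mathrm{Hom}}_R(X,Y)=\mathrm{Hom}_R(X,Y)/P(X,Y)$,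 where $P(X,Y)$ is the submodule of homomorphisms that factor through projective modules. For a module $X$, $\mathrm{Ext}^1_R(-,X)|_{\underline{\mathcal C}}$ denotes the contravariant functor on $\underline{\mathcal C}$ induced by $W\mapsto\mathrm{Ext}^1_R(W,X)$, $W\in\mathcal C$. $\mathrm{mod}\,\underline{\mathcal C}$ is the category of finitely presented contravariant additive functors $F$ from $\underline{\mathcal C}$ to abelian groups, with natural transformations as morphisms; finitely presented means that there is an exact sequence $\underline{\mathrm{Hom}}_R(-,X_1)|_{\underline{\mathcal C}}\to\underline{\mathrm{Hom}}_R(-,X_0)|_{\underline{\mathcal C}}\to F\to 0$ with $X_0,X_1\in\mathcal C$. A category is *Frobenius* if it is an abelian category with enough projectives and enough injectives, all projective objects are injective, and all injective objects are projective. *)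

(* Defs.v *)
From HB Require Import structures.
From mathcomp Require Import all_boot all_algebra.
From mathcomp Require Import boolp classical_sets.
Set Implicit Arguments.
Unset Strict Implicit.
Unset Printing Implicit Defensive.
Import GRing.Theory.
Local Open Scope ring_scope.

Section Rings.
Variable R : comNzRingType.

Definition ideal (I : set R) : Prop :=
  [/\ I 0, forall x y, I x -> I y -> I (x + y) & forall a x, I x -> I (a * x)].

Definition noetherian : Prop :=
  forall I, ideal I -> exists (n : nat) (g : 'I_n -> R),
    forall x, I x <-> exists c : 'I_n -> R, x = \sum_i c i * g i.

Definition maximal_ideal (m : set R) : Prop :=
  [/\ ideal m, ~ m 1 &
      forall I, ideal I -> ~ I 1 -> (forall x, m x -> I x) -> I = m].

Definition local_ring : Prop := exists! m, maximal_ideal m.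

(* Simple roots of monic polynomials lift from the residue field; this is
   written with representatives in R of elements of R/m. *)
Definition henselian_local : Prop :=
  local_ring /\
  forall m, maximal_ideal m ->
  forall (p : {poly R}) (a : R),
    p \is monic -> m p.[a] -> ~ m p^`().[a] ->
  exists b, p.[b] = 0 /\ m (b - a).

End Rings.

Section LHom.
Variable R : comNzRingType.
Implicit Types X Y Z : lmodType R.

Definition lhom X Y := {linear X -> Y}.

Lemma lhom_ext X Y (f g : lhom X Y) : f =1 g -> f = g.
Proof.
case: f g => f [[hf1] [hf2]] [g [[hg1] [hg2]]] /= /funext fg; subst g.
by rewrite (Prop_irrelevance hf1 hg1) (Prop_irrelevance hf2 hg2).
Qed.

Variables X Y : lmodType R.

HB.instance Definition _ := gen_eqMixin (lhom X Y).
HB.instance Definition _ := gen_choiceMixin (lhom X Y).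

Definition lhom0 : lhom X Y := \0.
Definition lhomD (f g : lhom X Y) : lhom X Y := f \+ g.
Definition lhomN (f : lhom X Y) : lhom X Y := \- f.

Fact lhomDA : associative lhomD.
Proof. by move=> f g h; apply: lhom_ext => x /=; rewrite addrA. Qed.
Fact lhomDC : commutative lhomD.
Proof. by move=> f g; apply: lhom_ext => x /=; rewrite addrC. Qed.
Fact lhom0D : left_id lhom0 lhomD.
Proof. by move=> f; apply: lhom_ext => x /=; rewrite add0r. Qed.
Fact lhomND : left_inverse lhom0 lhomN lhomD.
Proof. by move=> f; apply: lhom_ext => x /=; rewrite addNr. Qed.

HB.instance Definition _ :=
  GRing.isZmodule.Build (lhom X Y) lhomDA lhomDC lhom0D lhomND.

Definition lhomZ (a : R) (f : lhom X Y) : lhom X Y := a \*: f.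

Fact lhomZA a b f : lhomZ a (lhomZ b f) = lhomZ (a * b) f.
Proof. by apply: lhom_ext => x /=; rewrite scalerA. Qed.
Fact lhom1Z : left_id 1 lhomZ.
Proof. by move=> f; apply: lhom_ext => x /=; rewrite scale1r. Qed.
Fact lhomZDr : right_distributive lhomZ +%R.
Proof. by move=> a f g; apply: lhom_ext => x /=; rewrite scalerDr. Qed.
Fact lhomZDl f : {morph lhomZ^~ f : a b / a + b}.
Proof. by move=> a b; apply: lhom_ext => x /=; rewrite scalerDl. Qed.

HB.instance Definition _ := GRing.Zmodule_isLmodule.Build R (lhom X Y)
  lhomZA lhom1Z lhomZDr lhomZDl.

End LHom.

Section Modules.
Variable R : comNzRingType.
Implicit Types X Y Z P : lmodType R.

Definition surjective_map (A B : Type) (f : A -> B) : Prop :=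
  forall y, exists x, f x = y.

Definition exact_at X Y Z (f : lhom X Y) (g : lhom Y Z) : Prop :=
  forall y, g y = 0 <-> exists x, f x = y.

Definition short_exact X Y Z (f : lhom X Y) (g : lhom Y Z) : Prop :=
  [/\ injective f, exact_at f g & surjective_map g].

Definition fingen X : Prop :=
  exists (n : nat) (g : 'I_n -> X),
    forall x, exists c : 'I_n -> R, x = \sum_i c i *: g i.

Definition projective P : Prop :=
  forall Y Z (g : lhom Y Z) (h : lhom P Z), surjective_map g ->
  exists k : lhom P Y, forall x, g (k x) = h x.

Definition isomorphic X Y : Prop := exists f : lhom X Y, bijective f.

Record subcategory (C : lmodType R -> Prop) : Prop := Subcategory {
  subcat_fingen : forall X, C X -> fingen X;
  subcat_iso : forall X Y, isomorphic X Y -> C X -> C Y;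
  subcat_sum : forall X Y, fingen X -> fingen Y ->
    (C (X * Y)%type <-> C X /\ C Y);
  subcat_proj : forall P, fingen P -> projective P -> C P
}.

Definition resolving (C : lmodType R -> Prop) : Prop :=
  forall X Y Z (f : lhom X Y) (g : lhom Y Z),
    fingen X -> fingen Y -> fingen Z -> short_exact f g ->
    (C X -> C Z -> C Y) /\ (C Y -> C Z -> C X).

Record resolution X := Resolution {
  res_ob : nat -> lmodType R;
  res_d : forall n, lhom (res_ob n.+1) (res_ob n);
  res_aug : lhom (res_ob 0) X;
  res_fingen : forall n, fingen (res_ob n);
  res_projective : forall n, projective (res_ob n);
  res_aug_surj : surjective_map res_aug;
  res_exact0 : exact_at (res_d 0) res_aug;
  res_exactS : forall n, exact_at (res_d n.+1) (res_d n)
}.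

Definition cocycle X (P : resolution X) Y n (f : lhom (res_ob P n) Y) : Prop :=
  forall x, f (res_d P n x) = 0.

Definition coboundary X (P : resolution X) Y n :
    lhom (res_ob P n) Y -> Prop :=
  match n with
  | 0 => fun f => f = 0
  | m.+1 => fun f => exists g : lhom (res_ob P m) Y,
                       forall x, f x = g (res_d P m x)
  end.

(* Ext^n_R(X, Y) = 0, i.e. H^n(Hom_R(P, Y)) = 0.  The cohomology does not
   depend on the resolution P of X by finitely generated projectives; one
   exists for each X in mod R since R is Noetherian. *)
Definition Ext_zero n X Y : Prop :=
  forall (P : resolution X) (f : lhom (res_ob P n) Y),
    cocycle f -> coboundary f.

Definition dual P : lmodType R := lhom P R^o.

Definition dual_fun X Y (d : lhom X Y) (f : dual Y) : dual X := f \o d.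

Fact dual_fun_linear X Y (d : lhom X Y) : linear (dual_fun d).
Proof. by move=> a f g; apply: lhom_ext. Qed.

HB.instance Definition _ X Y (d : lhom X Y) :=
  GRing.isLinear.Build R (dual Y) (dual X) _ (dual_fun d) (dual_fun_linear d).

Definition dual_map X Y (d : lhom X Y) : lhom (dual Y) (dual X) := dual_fun d.

(* Tr X is only defined up to projective summands, hence the relation: T is
   the cokernel of the dual of some projective presentation of X. *)
Definition is_transpose X T : Prop :=
  exists (P1 P0 : lmodType R) (d : lhom P1 P0) (e : lhom P0 X),
    [/\ fingen P1 /\ projective P1, fingen P0 /\ projective P0,
        exact_at d e, surjective_map e &
        exists q : lhom (dual P1) T,
          exact_at (dual_map d) q /\ surjective_map q].

Definition G_category X : Prop :=
  fingen X /\
  forall i, (0 < i)%N ->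
    Ext_zero i X R^o /\ forall T, is_transpose X T -> Ext_zero i T R^o.

(* A functor with values in abelian groups is zero iff all its values are, and
   the objects of the stable category of C are those of C. *)
Definition Ext1_functor_zero (C : lmodType R -> Prop) X : Prop :=
  forall W, C W -> Ext_zero 1 W X.

End Modules.

(* The hom-sets carry their own abelian group operations, and not a [zmodType]:
   natural transformations quantify over all objects and live in a universe
   too large for [zmodType]. *)
Record preadditive := Preadditive {
  ob :> Type;
  hom : ob -> ob -> Type;
  idm : forall X, hom X X;
  comp : forall X Y Z, hom Y Z -> hom X Y -> hom X Z;
  zerom : forall X Y, hom X Y;
  addm : forall X Y, hom X Y -> hom X Y -> hom X Y;
  oppm : forall X Y, hom X Y -> hom X Y;
  compA : forall X Y Z T (h : hom Z T) (g : hom Y Z) (f : hom X Y),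
    comp h (comp g f) = comp (comp h g) f;
  comp1m : forall X Y (f : hom X Y), comp (idm Y) f = f;
  compm1 : forall X Y (f : hom X Y), comp f (idm X) = f;
  addmA : forall X Y, associative (@addm X Y);
  addmC : forall X Y, commutative (@addm X Y);
  add0m : forall X Y, left_id (zerom X Y) (@addm X Y);
  addNm : forall X Y, left_inverse (zerom X Y) (@oppm X Y) (@addm X Y);
  compDl : forall X Y Z (g h : hom Y Z) (f : hom X Y),
    comp (addm g h) f = addm (comp g f) (comp h f);
  compDr : forall X Y Z (g : hom Y Z) (f h : hom X Y),
    comp g (addm f h) = addm (comp g f) (comp g h)
}.

Arguments hom {p} X Y.
Arguments idm {p} X.
Arguments comp {p X Y Z} g f.
Arguments zerom {p} X Y.
Arguments addm {p X Y} f g.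
Arguments oppm {p X Y} f.

Section Categories.
Variable A : preadditive.
Implicit Types X Y Z W : A.

Definition mono X Y (f : hom X Y) : Prop :=
  forall W (g h : hom W X), comp f g = comp f h -> g = h.

Definition epi X Y (f : hom X Y) : Prop :=
  forall W (g h : hom Y W), comp g f = comp h f -> g = h.

Definition is_kernel X Y (f : hom X Y) K (k : hom K X) : Prop :=
  comp f k = zerom K Y /\
  forall W (g : hom W X), comp f g = zerom W Y ->
    exists! h : hom W K, comp k h = g.

Definition is_cokernel X Y (f : hom X Y) Q (q : hom Y Q) : Prop :=
  comp q f = zerom X Q /\
  forall W (g : hom Y W), comp g f = zerom X W ->
    exists! h : hom Q W, comp h q = g.

Definition zero_object Z : Prop :=
  (forall X, exists! f : hom Z X, True) /\ (forall X, exists! f : hom X Z, True).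

Definition has_biproduct X Y : Prop :=
  exists (B : A) (i1 : hom X B) (i2 : hom Y B) (p1 : hom B X) (p2 : hom B Y),
    [/\ comp p1 i1 = idm X, comp p2 i2 = idm Y,
        comp p2 i1 = zerom X Y, comp p1 i2 = zerom Y X &
        addm (comp i1 p1) (comp i2 p2) = idm B].

Record abelian : Prop := Abelian {
  abelian_zero : exists Z, zero_object Z;
  abelian_biproduct : forall X Y, has_biproduct X Y;
  abelian_kernel : forall X Y (f : hom X Y),
    exists K (k : hom K X), is_kernel f k;
  abelian_cokernel : forall X Y (f : hom X Y),
    exists Q (q : hom Y Q), is_cokernel f q;
  abelian_mono : forall X Y (f : hom X Y), mono f ->
    exists Z (g : hom Y Z), is_kernel g f;
  abelian_epi : forall X Y (f : hom X Y), epi f ->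
    exists Z (g : hom Z X), is_cokernel g f
}.

Definition projective_object P : Prop :=
  forall X Y (e : hom X Y) (f : hom P Y), epi e ->
    exists h : hom P X, comp e h = f.

Definition injective_object I : Prop :=
  forall X Y (m : hom X Y) (f : hom X I), mono m ->
    exists h : hom Y I, comp h m = f.

Definition enough_projectives : Prop :=
  forall X, exists P (e : hom P X), projective_object P /\ epi e.

Definition enough_injectives : Prop :=
  forall X, exists I (m : hom X I), injective_object I /\ mono m.

Record frobenius : Prop := Frobenius {
  frobenius_abelian : abelian;
  frobenius_enough_projectives : enough_projectives;
  frobenius_enough_injectives : enough_injectives;
  frobenius_projective_injective :
    forall X, projective_object X -> injective_object X;
  frobenius_injective_projective :
    forall X, injective_object X -> projective_object X
}.

End Categories.

Lemma additive_ext (U V : zmodType) (f g : {additive U -> V}) :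
  f =1 g -> f = g.
Proof.
case: f g => f [[hf]] [g [[hg]]] /= /funext fg; subst g.
by rewrite (Prop_irrelevance hf hg).
Qed.

Section Functors.
Variable A : preadditive.

Record cofunctor := Cofunctor {
  fob :> A -> zmodType;
  fmap : forall X Y : A, hom X Y -> {additive fob Y -> fob X};
  fmap1 : forall (X : A) (x : fob X), fmap (idm X) x = x;
  fmapM : forall (X Y Z : A) (g : hom Y Z) (f : hom X Y) (x : fob Z),
    fmap (comp g f) x = fmap f (fmap g x);
  fmapD : forall (X Y : A) (f g : hom X Y) (x : fob Y),
    fmap (addm f g) x = fmap f x + fmap g x
}.

Record nattrans (F G : cofunctor) := Nattrans {
  ntc :> forall X : A, {additive F X -> G X};
  ntcN : forall (X Y : A) (f : hom X Y) (x : F Y),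
    ntc X (fmap F f x) = fmap G f (ntc Y x)
}.

Lemma nattrans_ext (F G : cofunctor) (a b : nattrans F G) :
  (forall X x, a X x = b X x) -> a = b.
Proof.
case: a b => a ha [b hb] /= ab.
have {}ab : a = b.
  apply: functional_extensionality_dep => X.
  by apply: additive_ext => x; apply: ab.
by subst b; rewrite (Prop_irrelevance ha hb).
Qed.

#[local] Obligation Tactic := idtac.

Section Operations.
Variables F G H : cofunctor.

Definition nt_id : nattrans F F :=
  @Nattrans F F (fun X => idfun) (fun X Y f x => erefl).

Program Definition nt_comp (b : nattrans G H) (a : nattrans F G) :
  nattrans F H := @Nattrans F H (fun X => b X \o a X) _.
Next Obligation. by move=> b a X Y f x /=; rewrite !ntcN. Qed.

Program Definition nt_zero : nattrans F G := @Nattrans F G (fun X => \0) _.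
Next Obligation. by move=> X Y f x /=; rewrite raddf0. Qed.

Program Definition nt_add (a b : nattrans F G) : nattrans F G :=
  @Nattrans F G (fun X => a X \+ b X) _.
Next Obligation. by move=> a b X Y f x /=; rewrite !ntcN raddfD. Qed.

Program Definition nt_opp (a : nattrans F G) : nattrans F G :=
  @Nattrans F G (fun X => \- a X) _.
Next Obligation. by move=> a X Y f x /=; rewrite ntcN raddfN. Qed.

End Operations.

Program Definition full_functor_category (Q : cofunctor -> Prop) :
  preadditive := {|
    ob := {F : cofunctor | Q F};
    hom := fun F G => nattrans (sval F) (sval G);
    idm := fun F => nt_id (sval F);
    comp := fun F G H b a => nt_comp b a;
    zerom := fun F G => nt_zero (sval F) (sval G);
    addm := fun F G a b => nt_add a b;
    oppm := fun F G a => nt_opp a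
  |}.
Next Obligation. by move=> *; apply: nattrans_ext. Qed.
Next Obligation. by move=> *; apply: nattrans_ext. Qed.
Next Obligation. by move=> *; apply: nattrans_ext. Qed.
Next Obligation.
by move=> Q F G a b c; apply: nattrans_ext => X x /=; rewrite addrA.
Qed.
Next Obligation.
by move=> Q F G a b; apply: nattrans_ext => X x /=; rewrite addrC.
Qed.
Next Obligation.
by move=> Q F G a; apply: nattrans_ext => X x /=; rewrite add0r.
Qed.
Next Obligation.
by move=> Q F G a; apply: nattrans_ext => X x /=; rewrite addNr.
Qed.
Next Obligation. by move=> *; apply: nattrans_ext. Qed.
Next Obligation. by move=> *; apply: nattrans_ext => X x /=; rewrite raddfD. Qed.

End Functors.

Section StableHom.
Variable R : comNzRingType.
Implicit Types X Y Z : lmodType R.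

Definition factors_through_projective X Y (f : lhom X Y) : Prop :=
  exists (P : lmodType R) (g : lhom X P) (h : lhom P Y),
    projective P /\ forall x, f x = h (g x).

Definition proj_homs X Y : {pred lhom X Y} :=
  fun f => `[< factors_through_projective f >].

Lemma projective_prod (P Q : lmodType R) :
  projective P -> projective Q -> projective (P * Q)%type.
Proof.
move=> hP hQ Y Z g h gsurj.
pose i1 (x : P) : P * Q := (x, 0).
pose i2 (y : Q) : P * Q := (0, y).
have i1l : linear i1 by move=> a x y; congr (_, _); rewrite /= ?scaler0 ?addr0.
have i2l : linear i2 by move=> a x y; congr (_, _); rewrite /= ?scaler0 ?addr0.
pose i1L := GRing.isLinear.Build _ _ _ _ i1 i1l.
pose i2L := GRing.isLinear.Build _ _ _ _ i2 i2l.
pose I1 : lhom P (P * Q)%type := HB.pack_for {linear _ -> _} i1 i1L.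
pose I2 : lhom Q (P * Q)%type := HB.pack_for {linear _ -> _} i2 i2L.
have [k1 k1P] := hP _ _ g (h \o I1) gsurj.
have [k2 k2P] := hQ _ _ g (h \o I2) gsurj.
exists ((k1 \o fst) \+ (k2 \o snd)) => -[x y] /=.
rewrite linearD k1P k2P /= -linearD /i1 /i2; congr (h (_, _)).
  by rewrite addr0.
by rewrite add0r.
Qed.

Fact proj_homs_zmod_closed X Y : zmod_closed (@proj_homs X Y).
Proof.
split.
  apply/asboolP; exists 'rV[R]_0, \0, \0; split=> // M N g h gsurj.
  by exists \0 => x /=; rewrite (thinmx0 x) !linear0.
move=> f f' /asboolP[P [g [h [hP fE]]]] /asboolP[P' [g' [h' [hP' fE']]]].
pose s (x : X) : P * P' := (g x, g' x).
have sl : linear s by move=> a x y; rewrite /s !linearP.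
pose sL := GRing.isLinear.Build _ _ _ _ s sl.
pose S : lhom X (P * P')%type := HB.pack_for {linear _ -> _} s sL.
apply/asboolP; exists (P * P')%type, S, ((h \o fst) \- (h' \o snd)).
by split; [exact: projective_prod | move=> x /=; rewrite -fE -fE'].
Qed.

HB.instance Definition _ X Y :=
  GRing.isZmodClosed.Build (lhom X Y) (@proj_homs X Y)
    (@proj_homs_zmod_closed X Y).

Definition stable_hom X Y : zmodType := Quotient.quot (@proj_homs X Y).

Definition stable_class X Y (f : lhom X Y) : stable_hom X Y :=
  (\pi_(Quotient.quot (@proj_homs X Y)) f)%qT.

Definition stable_repr X Y (f : stable_hom X Y) : lhom X Y := repr f.

Lemma stable_reprK X Y (f : stable_hom X Y) : stable_class (stable_repr f) = f.
Proof. exact: reprK. Qed.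

Lemma stable_classP X Y (f g : lhom X Y) :
  stable_class f = stable_class g <-> factors_through_projective (f - g).
Proof.
rewrite -(asboolE (factors_through_projective _)).
rewrite -[X in _ <-> is_true X]/((f - g) \in @proj_homs X Y) Quotient.idealrBE.
by split=> /eqP.
Qed.

Lemma stable_classD X Y (f g : lhom X Y) :
  stable_class (f + g) = stable_class f + stable_class g.
Proof. by rewrite /stable_class !piE. Qed.

Definition stable_comp X Y Z (g : stable_hom Y Z) (f : stable_hom X Y) :
    stable_hom X Z :=
  stable_class (stable_repr g \o stable_repr f).

Lemma stable_compE X Y Z (g : lhom Y Z) (f : lhom X Y) :
  stable_comp (stable_class g) (stable_class f) = stable_class (g \o f).
Proof.
set g' := stable_repr (stable_class g); set f' := stable_repr (stable_class f).
have /stable_classP[P [a [b [hP gE]]]] : stable_class g' = stable_class g.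
  exact: stable_reprK.
have /stable_classP[Q [c [d [hQ fE]]]] : stable_class f' = stable_class f.
  exact: stable_reprK.
rewrite /stable_comp -/g' -/f'.
transitivity (stable_class (g \o f' : lhom X Z)); apply/stable_classP.
  by exists P, (a \o f'), b; split=> // x /=; rewrite -gE.
exists Q, c, (g \o d); split=> // x /=; rewrite -fE /=.
by rewrite -[RHS]/(g (f' x - f x)) linearB.
Qed.

End StableHom.

Section StableCategory.
Variables (R : comNzRingType) (C : lmodType R -> Prop).

#[local] Obligation Tactic := idtac.

Program Definition stable_category : preadditive := {|
    ob := {X : lmodType R | C X};
    hom := fun X Y => stable_hom (sval X) (sval Y);
    idm := fun X => stable_class (idfun : lhom (sval X) (sval X));
    comp := fun X Y Z g f => stable_comp g f;
    zerom := fun X Y => 0;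
    addm := fun X Y f g => f + g;
    oppm := fun X Y f => - f
  |}.
Next Obligation.
move=> X Y Z T h g f; rewrite -(stable_reprK h) -(stable_reprK g).
rewrite -(stable_reprK f) !stable_compE; congr stable_class.
exact: lhom_ext.
Qed.
Next Obligation.
move=> X Y f; rewrite -(stable_reprK f) stable_compE; congr stable_class.
exact: lhom_ext.
Qed.
Next Obligation.
move=> X Y f; rewrite -(stable_reprK f) stable_compE; congr stable_class.
exact: lhom_ext.
Qed.
Next Obligation. by move=> X Y; exact: addrA. Qed.
Next Obligation. by move=> X Y; exact: addrC. Qed.
Next Obligation. by move=> X Y; exact: add0r. Qed.
Next Obligation. by move=> X Y; exact: addNr. Qed.
Next Obligation.
move=> X Y Z g h f; rewrite -(stable_reprK h) -(stable_reprK g).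
rewrite -(stable_reprK f) -stable_classD !stable_compE -stable_classD.
by congr stable_class; apply: lhom_ext.
Qed.
Next Obligation.
move=> X Y Z g f h; rewrite -(stable_reprK h) -(stable_reprK g).
rewrite -(stable_reprK f) -stable_classD !stable_compE -stable_classD.
by congr stable_class; apply: lhom_ext => x /=; rewrite linearD.
Qed.

Implicit Types X Y : stable_category.

Definition stable_precomp X Y Z (f : hom X Y) (g : stable_hom (sval Y) (sval Z)) :
    stable_hom (sval X) (sval Z) :=
  @comp stable_category X Y Z g f.

Fact stable_precomp_additive X Y Z (f : hom X Y) :
  zmod_morphism (@stable_precomp X Y Z f).
Proof.
move=> g h; apply: (@addIr _ (stable_precomp f h)).
by rewrite -[LHS](@compDl stable_category) /= !subrK.
Qed.

HB.instance Definition _ X Y Z (f : hom X Y) :=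
  GRing.isZmodMorphism.Build (stable_hom (sval Y) (sval Z))
    (stable_hom (sval X) (sval Z)) (@stable_precomp X Y Z f)
    (@stable_precomp_additive X Y Z f).

Program Definition representable (Z : stable_category) :
  cofunctor stable_category := {|
    fob := fun X => stable_hom (sval X) (sval Z);
    fmap := fun X Y f => @stable_precomp X Y Z f
  |}.
Next Obligation. by move=> Z X x; exact: (@compm1 stable_category). Qed.
Next Obligation. by move=> Z X Y T g f x; exact: (@compA stable_category). Qed.
Next Obligation. by move=> Z X Y f g x; exact: (@compDr stable_category). Qed.

(* Exactness of Hom(-,X1) -> Hom(-,X0) -> F -> 0 is objectwise. *)
Definition finitely_presented (F : cofunctor stable_category) : Prop :=
  exists (X1 X0 : stable_category)
    (a : nattrans (representable X1) (representable X0))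
    (b : nattrans (representable X0) F),
    forall W : stable_category,
      surjective_map (b W) /\
      (forall x, b W x = 0 <-> exists z, a W z = x).

Definition mod_stable : preadditive :=
  full_functor_category finitely_presented.

End StableCategory.

(* Main.v *)
(* Maps that factor through projectives are called stably zero; the weak
   kernel of f : U -> X in the stable category is read off the pullback of f
   along a projective cover of X.  Since epimorphisms of mod C are pointwise
   surjective, representable functors are projective, hence injective, and
   every functor embeds into a representable one.

   Ext^1(X, R) = 0 for X in C.  For 0 -> R -> Y -> X -> 0 the map Y -> X is
   stably a monomorphism, hence stably split, and the sequence is the pullback
   of one 0 -> R -> R^k -> Z -> 0 with Z in C.  Stable splitness of the
   universal extension of Z^k by Z, with a Nakayama argument, splits the
   latter.

   Every X in C embeds into a projective P with P / X in C.  If X is not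
   projective, some phi : Omega W -> X is not stably zero.  The image of
   Hom(-, Omega W) in Hom(-, X) also embeds into some Hom(-, Omega V), and
   injectivity gives an endomorphism e of X that factors through Omega V and
   fixes phi.  As R is henselian, e has a Fitting decomposition: a nonzero
   summand of X on which e is invertible is a summand of Omega V, so it has a
   cosyzygy in C.  Noetherian induction handles the complement.

   With these two facts the syzygy of a transpose of X is a transpose of the
   cosyzygy of X, and functionals on it extend; dimension shifting concludes. *)

From HB Require Import structures.
From Pilot Require Import Defs.
From mathcomp Require Import all_boot all_algebra perm.
From mathcomp Require Import boolp mpoly ring.
Import Pilot.Defs.
Set Implicit Arguments.
Unset Strict Implicit.
Unset Printing Implicit Defensive.
Import GRing.Theory Pdiv.CommonRing Pdiv.RingMonic.
Local Open Scope ring_scope.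

(** * Hensel factorization *)

(** The henselian hypothesis yields only simple roots of monic polynomials, while a Fitting
    decomposition of [e] needs an annihilating polynomial factored into a part congruent to a power
    of ['X] and a part with unit constant term. The bridge is a resolvent: the product of the roots
    of the second part is a simple root of the polynomial whose roots are the products over all sets
    of that many roots. Symmetric functions then bring the factorization back to [R]. No
    decomposition into indecomposables is used. Fitting is applied to a single [e], and its summand
    is nonzero because on the complement [id - e] is invertible, whereas [e] fixes [phi] up to
    stably zero maps. The vanishing of Ext against [R] has to come before the cosyzygies: hypothesis
    (3) gives a nonzero class in some Ext^1(W, X), and only because maps from a syzygy of [W] to
    free modules extend does this class produce a map that is not stably zero. Syzygies are taken
    along arbitrary free covers, never minimal ones, so modules are controlled only up to projective
    summands; hence the stable formulations throughout. *)

Section Ideals.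
Variables (R : comNzRingType) (I : R -> Prop).
Hypothesis idI : ideal I.

Lemma ideal0 : I 0. Proof. by case: idI. Qed.
Lemma idealD x y : I x -> I y -> I (x + y). Proof. by case: idI => _ + _; apply. Qed.
Lemma ideal_mull a x : I x -> I (a * x). Proof. by case: idI => _ _; apply. Qed.
Lemma ideal_mulr a x : I x -> I (x * a). Proof. by rewrite mulrC; apply: ideal_mull. Qed.
Lemma idealN x : I x -> I (- x). Proof. by rewrite -mulN1r; apply: ideal_mull. Qed.
Lemma idealB x y : I x -> I y -> I (x - y).
Proof. by move=> Ix /idealN; apply: idealD. Qed.

Lemma ideal_sum (T : Type) (r : seq T) (P : pred T) (F : T -> R) :
  (forall i, P i -> I (F i)) -> I (\sum_(i <- r | P i) F i).
Proof. by move=> h; elim/big_ind: _ => //; [exact: ideal0 | exact: idealD]. Qed.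

Lemma ideal_congM x x' y y' : I (x - x') -> I (y - y') -> I (x * y - x' * y').
Proof.
move=> hx hy; have -> : x * y - x' * y' = (x - x') * y + x' * (y - y') by ring.
by apply: idealD; [apply: ideal_mulr | apply: ideal_mull].
Qed.

Lemma ideal_congX x x' k : I (x - x') -> I (x ^+ k - x' ^+ k).
Proof.
move=> h; elim: k => [|k IH]; first by rewrite subrr; exact: ideal0.
by rewrite !exprS; apply: ideal_congM.
Qed.

Lemma ideal_cong_trans x y z : I (x - y) -> I (y - z) -> I (x - z).
Proof. by move=> hx hy; rewrite -[x](subrK y) -addrA; apply: idealD. Qed.

Lemma ideal_cong_horner (p q : {poly R}) (x y : R) :
  (forall i, I (p`_i - q`_i)) -> I (x - y) -> I (p.[x] - q.[y]).
Proof.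
move=> pq xy; pose n := maxn (size p) (size q).
rewrite (@horner_coef_wide _ n p) ?leq_maxl //.
rewrite (@horner_coef_wide _ n q) ?leq_maxr // -sumrB.
by apply: ideal_sum => i _; apply: ideal_congM; last exact: ideal_congX.
Qed.

Lemma ideal_cong_deriv (p q : {poly R}) :
  (forall i, I (p`_i - q`_i)) -> forall i, I (p^`()`_i - q^`()`_i).
Proof.
by move=> pq i; rewrite !coef_deriv -mulrnBl -mulr_natl; apply: ideal_mull.
Qed.

End Ideals.

(** Roots are adjoined one at a time: the class of the variable is a root of [P] in [R[X]/P], and a
    linear factor splits off. Since [P] is monic of positive degree, constants embed. The ring [S]
    need not be a domain; injectivity of [f] suffices to pull identities back to [R]. *)
Lemma monic_split n (R : comNzRingType) (P : {poly R}) :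
  P \is monic -> size P = n.+1 ->
  exists (S : comNzRingType) (f : {rmorphism R -> S}) (l : 'I_n -> S),
    injective f /\ map_poly f P = \prod_i ('X - (l i)%:P).
Proof.
elim: n R P => [|n IH] R P Pm sP.
  exists R, idfun, (fun=> 0); split=> //; rewrite big_ord0 map_poly_id //.
  have /size1_polyC P1 : (size P <= 1)%N by rewrite sP.
  by move: Pm; rewrite P1 monicE lead_coefC => /eqP ->.
(* The quotient ring is formed with [mk_monic P], which is [P] itself only when [P] is monic and
   nonconstant. *)
have mP : mk_monic P = P by rewrite /mk_monic sP Pm.
pose Q : comNzRingType := {poly %/ P}.
pose f : {rmorphism R -> Q} := qpolyC P.
have rP : (map_poly f P).['qX] = 0.
  have -> : map_poly f P = map_poly (in_qpoly P) (map_poly polyC P).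
    apply/polyP => i; rewrite !coef_map /=; apply: val_inj => /=.
    rewrite mP rmodp_small // sP size_polyC.
    by case: (_ != _).
  rewrite horner_map -/(_ \Po _) comp_polyXr; apply: val_inj => /=.
  by rewrite mP rmodpp.
have [P' PE] := factor_theorem _ _ (introT eqP rP).
have fPm : map_poly f P \is monic by exact: monic_map.
have P'm : P' \is monic by move: fPm; rewrite PE monicMr // monicXsubC.
have sP' : size P' = n.+1.
  have : size (map_poly f P) = n.+2.
    by rewrite size_map_poly_id0 // (monicP Pm) rmorph1 oner_neq0.
  by rewrite PE size_Mmonic ?monicXsubC ?monic_neq0 // size_XsubC addn2 => -[].
have [S [g [l [gi lE]]]] := IH _ _ P'm sP'.
exists S, (g \o f), (fun i => oapp l (g 'qX) (unlift ord0 i)); split.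
  apply: inj_comp => // x y /(congr1 val) /= /polyP /(_ 0%N).
  by rewrite !coefC.
rewrite map_poly_comp PE rmorphM /= lE rmorphB /= map_polyX map_polyC /= mulrC.
rewrite big_ord_recl unlift_none /=; congr (_ * _).
by apply: eq_bigr => i _; rewrite liftK.
Qed.

(** * Symmetric functions of the roots of a monic polynomial *)

Section SymmetricEvaluation.
Variables (R : comNzRingType) (n : nat).

Definition splits (S : comNzRingType) (f : {rmorphism R -> S}) (l : 'I_n -> S)
    (P : {poly R}) :=
  map_poly f P = \prod_i ('X - (l i)%:P).

Lemma mesym_splits (S : comNzRingType) (f : {rmorphism R -> S}) l P k :
  splits f l P -> (k <= n)%N ->
  mmap f l (mesym n R k) = (-1) ^+ k * f P`_(n - k).
Proof.
move=> sp kn; rewrite -coef_map sp.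
(* Vieta's formula is an identity over [int]; its variables are specialized to the roots. *)
have -> : \prod_i ('X - (l i)%:P) =
    map_poly (mmap intr l : {rmorphism {mpoly int[n]} -> S})
      (\prod_(i < n) ('X - ('X_i)%:P)).
  rewrite rmorph_prod /=; apply: eq_bigr => i _.
  by rewrite rmorphB /= map_polyX map_polyC /= mmapX mmap1U.
rewrite Viete [map_poly _ _]raddf_sum coef_sum /= (bigD1 (Ordinal (kn : k < n.+1)%N)) //=.
rewrite big1 ?addr0 => [|i ik]; last first.
  rewrite !map_polyZ /= map_polyXn !coefZ coefXn.
  case: eqP => [e|]; last by rewrite !mulr0.
  case/eqP: ik; apply: val_inj => /=.
  by rewrite -(subKn kn) e subKn // -ltnS.
rewrite !map_polyZ !rmorphXn /= raddfN /= mmapC !coefZ /= map_polyX coefXn.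
rewrite eqxx mulr1 mulrA -exprMn mulrNN mulr1 expr1n mul1r.
rewrite /mesym !raddf_sum /=; apply: eq_bigr => A _.
rewrite !rmorph_prod /=; apply: eq_bigr => i _.
by rewrite !mmapX !mmap1U.
Qed.

(** By the fundamental theorem [p] is a polynomial in the elementary symmetric ones, hence in the
    coefficients of [P]. One [F] serves all splittings, so the values for two congruent polynomials
    that split in unrelated rings can be compared. *)
Lemma symmetric_eval (p : {mpoly R[n]}) : p \is symmetric ->
  exists F : {poly R} -> R,
    (forall (S : comNzRingType) (f : {rmorphism R -> S}) l P,
      splits f l P -> mmap f l p = f (F P)) /\
    (forall I (P P' : {poly R}), ideal I -> (forall i, I (P`_i - P'`_i)) -> I (F P - F P')).
Proof.
move=> /sym_fundamental[t [<- _]].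
pose e (P : {poly R}) (i : 'I_n) := (-1) ^+ i.+1 * P`_(n - i.+1).
exists (fun P => t.@[e P]); split=> [S f l P sp|I P P' idI h].
  rewrite comp_mpolyE mevalE !raddf_sum; apply: eq_bigr => m _ /=.
  rewrite mmapZ rmorphM /= !rmorph_prod /=; congr (_ * _).
  apply: eq_bigr => i _; rewrite !rmorphXn /= tnth_mktuple; congr (_ ^+ _).
  by rewrite (mesym_splits sp) // rmorphM rmorphXn /= rmorphN1.
rewrite !mevalE -sumrB; apply: ideal_sum => // m _; rewrite -mulrBr.
apply: ideal_mull => //; elim/big_rec2: _ => [|i x y _ xy].
  by rewrite subrr; exact: ideal0.
apply: ideal_congM => //; apply: ideal_congX => //; rewrite /e -mulrBr.
exact: ideal_mull.
Qed.

Lemma symmetric_poly_eval (p : {poly {mpoly R[n]}}) :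
  (forall s, map_poly (msym s) p = p) ->
  exists F : {poly R} -> {poly R},
    (forall (S : comNzRingType) (f : {rmorphism R -> S}) l P,
      splits f l P -> map_poly (mmap f l) p = map_poly f (F P)) /\
    (forall I (P P' : {poly R}), ideal I -> (forall i, I (P`_i - P'`_i)) ->
       forall i, I ((F P)`_i - (F P')`_i)).
Proof.
move=> psym.
have cs i : p`_i \is symmetric.
  by apply/issymP => s; rewrite -{2}(psym s) coef_map.
have [F FP] := choice (fun i => symmetric_eval (cs i)).
exists (fun P => \poly_(i < size p) F i P); split=> [S f l P sp|I P P' idI h i].
  apply/polyP => i; have [+ _] := FP i => /(_ _ _ _ _ sp) Fi.
  rewrite !coef_map coef_poly /= Fi; case: ltnP => // sz.
  by rewrite rmorph0 -Fi (nth_default _ sz) raddf0.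
rewrite !coef_poly; case: ifP => _; first by have [_] := FP i; apply.
by rewrite subrr; exact: ideal0.
Qed.

Variable b : nat.

Lemma sum_sets_symmetric (K : {set 'I_n} -> {poly {mpoly R[n]}}) :
  (forall (s : 'S_n) A, map_poly (msym s) (K A) = K (s @: A)) ->
  forall s : 'S_n, map_poly (msym s) (\sum_(A : {set 'I_n} | #|A| == b) K A) =
                  \sum_(A : {set 'I_n} | #|A| == b) K A.
Proof.
move=> KE s; rewrite raddf_sum /=.
rewrite [RHS](reindex_inj (imset_inj (@perm_inj _ s))) /=.
by apply: eq_big => [A|A _]; [rewrite card_imset //; exact: perm_inj|exact: KE].
Qed.

Lemma prod_sets_symmetric (K : {set 'I_n} -> {poly {mpoly R[n]}}) :
  (forall (s : 'S_n) A, map_poly (msym s) (K A) = K (s @: A)) ->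
  forall s : 'S_n, map_poly (msym s) (\prod_(A : {set 'I_n} | #|A| == b) K A) =
                  \prod_(A : {set 'I_n} | #|A| == b) K A.
Proof.
move=> KE s; rewrite rmorph_prod /=.
rewrite [RHS](reindex_inj (imset_inj (@perm_inj _ s))) /=.
by apply: eq_big => [A|A _]; [rewrite card_imset //; exact: perm_inj|exact: KE].
Qed.

Lemma msym_var (s : 'S_n) i : msym s ('X_i : {mpoly R[n]}) = 'X_(s i).
Proof. by rewrite /msym mmapX mmap1U. Qed.

Lemma msym_prod (s : 'S_n) (A : {set 'I_n}) :
  msym s (\prod_(i in A) 'X_i) = \prod_(i in s @: A) 'X_i :> {mpoly R[n]}.
Proof.
rewrite rmorph_prod /= big_imset; last by move=> x y _ _; exact: perm_inj.
by apply: eq_bigr => i _; exact: msym_var.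
Qed.

Definition root_factor (A : {set 'I_n}) : {poly {mpoly R[n]}} :=
  \prod_(i in A) ('X - ('X_i)%:P).

Lemma msym_root_factor (s : 'S_n) A :
  map_poly (msym s) (root_factor A) = root_factor (s @: A).
Proof.
rewrite rmorph_prod /= /root_factor big_imset; last first.
  by move=> x y _ _; exact: perm_inj.
apply: eq_bigr => i _.
by rewrite rmorphB /= map_polyX map_polyC /= msym_var.
Qed.

Lemma msym_horner (s : 'S_n) (Q : {poly R}) x :
  msym s (map_poly (@mpolyC n R) Q).[x] =
  (map_poly (@mpolyC n R) Q).[msym s x].
Proof.
rewrite -horner_map -map_poly_comp; congr (_.[_]).
by apply: eq_map_poly => c /=; rewrite /msym mmapC.
Qed.

Lemma imsetC_perm (s : 'S_n) (A : {set 'I_n}) : s @: (~: A) = ~: (s @: A).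
Proof.
apply/setP => x; rewrite -[x](permKV s) inE !mem_imset ?inE //; exact: perm_inj.
Qed.

End SymmetricEvaluation.

(** The difference [x - z] divides [p.[x] - p.[z]]. *)
Lemma horner_cong (S : comNzRingType) (p : {poly S}) x z y :
  (x - z) * y = 0 -> p.[x] * y = p.[z] * y.
Proof.
move=> h; apply/eqP; rewrite -subr_eq0 -mulrBl.
have /factor_theorem[q qE] : root (p - p.[z]%:P) z.
  by rewrite /root hornerD hornerN hornerC subrr.
have -> : p.[x] - p.[z] = (p - p.[z]%:P).[x] by rewrite hornerD hornerN hornerC.
by rewrite qE hornerM hornerXsubC -mulrA h mulr0.
Qed.

(* A simple root [z] of [\prod_A ('X - t A)] makes the [Q.[t A]] orthogonal,
   and idempotent up to the unit [Q.[z]]; cutting with them turns symmetrized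
   expressions in the roots into the individual ones. *)
Lemma symmetrized_factorization (S : comNzRingType) (T : finType) (P : pred T)
    (t : T -> S) (Q : {poly S}) (z d' : S) (g h : T -> {poly S}) (p : {poly S}) :
  \prod_(A | P A) ('X - (t A)%:P) = ('X - z%:P) * Q -> Q.[z] * d' = 1 ->
  (forall A, P A -> g A * h A = p) ->
  (\sum_(A | P A) Q.[t A]) *:
    ((\sum_(A | P A) Q.[t A] *: g A) * (\sum_(A | P A) Q.[t A] *: h A)
      - Q.[z] ^+ 2 *: p) = 0.
Proof.
set d := Q.[z] => TQ dd' gh.
have zQ A : P A -> (t A - z) * Q.[t A] = 0.
  move=> PA; rewrite -[LHS](_ : (('X - z%:P) * Q).[t A] = _); last first.
    by rewrite hornerM hornerXsubC.
  by rewrite -TQ (bigD1 A) //= hornerM hornerXsubC subrr mul0r.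
have cancel (M : lmodType S) (x : M) : d *: x = 0 -> x = 0.
  by move=> dx; rewrite -[x]scale1r -dd' mulrC -scalerA dx scaler0.
have idem A : P A -> Q.[t A] * Q.[t A] = d * Q.[t A].
  by move=> PA; apply: horner_cong; exact: zQ.
have orth A B : P A -> P B -> A != B -> Q.[t A] * Q.[t B] = 0.
  move=> PA PB AB; apply: (cancel S^o); rewrite /GRing.scale /=.
  (* [d] is the derivative at [z] of the full product. With the factors of [A] and [B] pulled out,
     every term of that derivative contains [z - t A] or [z - t B], which [Q.[t A] * Q.[t B]]
     kills. *)
  have -> : d = (('X - z%:P) * Q)^`().[z].
    rewrite derivM derivXsubC mul1r hornerD hornerM hornerXsubC subrr mul0r.
    by rewrite addr0.
  rewrite -TQ (bigD1 A) //= (bigD1 B) ?PB 1?eq_sym //=.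
  set q := \prod_(_ | _) _.
  rewrite mulrA !derivM !derivXsubC mul1r mulr1 hornerD !hornerM hornerD !hornerXsubC.
  have eA := zQ _ PA; have eB := zQ _ PB.
  set x := Q.[t A] in eA *; set y := Q.[t B] in eB *.
  have -> : ((z - t B + (z - t A)) * q.[z] + (z - t A) * (z - t B) * q^`().[z]) *
    (x * y) = - ((t B - z) * y) * x * q.[z] - ((t A - z) * x) * y * q.[z]
       + ((t A - z) * x) * ((t B - z) * y) * q^`().[z] by ring.
  by rewrite eA eB !mul0r oppr0 !mul0r !addr0.
have cut A (f : T -> {poly S}) : P A ->
    Q.[t A] *: (\sum_(B | P B) Q.[t B] *: f B) = (d * Q.[t A]) *: f A.
  move=> PA; rewrite scaler_sumr (bigD1 A) //= scalerA idem // big1 ?addr0 //.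
  by move=> B /andP[PB BA]; rewrite scalerA orth 1?eq_sym // scale0r.
set G := \sum_(A | P A) _ *: g A; set H := \sum_(A | P A) _ *: h A.
rewrite scaler_suml big1 // => A PA; rewrite scalerBr.
(* The extra factor [d] turns [Q.[t A]] into its square, which provides one cut for each of [G] and
   [H]. *)
apply: (cancel {poly S}); rewrite scalerBr.
rewrite [d *: (_ *: (G * H))]scalerA -idem // -scalerA scalerAl scalerAr.
rewrite !cut // -scalerAl -scalerAr gh // !scalerA -scalerBl.
rewrite -[RHS](scale0r p); congr (_ *: _).
transitivity (d ^+ 2 * (Q.[t A] * Q.[t A] - d * Q.[t A])); first by ring.
by rewrite idem // subrr mulr0.
Qed.

Section HenselFactorization.
Variables (R : comNzRingType) (m : R -> Prop).
Hypotheses (idm : ideal m) (m1 : ~ m 1).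
Hypothesis mU : forall x, ~ m x -> exists y, x * y = 1.
Hypothesis hens : forall (p : {poly R}) (a : R),
    p \is monic -> m p.[a] -> ~ m p^`().[a] ->
  exists b, p.[b] = 0 /\ m (b - a).

Lemma max_prime x y : m (x * y) -> m x \/ m y.
Proof.
move=> mxy; have [|/mU[z zE]] := EM (m x); first by left.
by right; rewrite -[y]mul1r -zE mulrAC; apply: ideal_mulr.
Qed.

Lemma notin_maxX x k : ~ m x -> ~ m (x ^+ k).
Proof.
by move=> mx; elim: k => [|k IH]; rewrite ?expr0 // exprS => /max_prime[].
Qed.

Lemma notin_max_cong x y : m (x - y) -> ~ m y -> ~ m x.
Proof. by move=> h my mx; apply: my; rewrite -[y](subKr x); exact: idealB. Qed.

Lemma root_factor_mmap (n : nat) (S : comNzRingType) (f : {rmorphism R -> S})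
    (l : 'I_n -> S) (A : {set 'I_n}) :
  map_poly (mmap f l) (root_factor R A) = \prod_(i in A) ('X - (l i)%:P).
Proof.
rewrite rmorph_prod /=; apply: eq_bigr => i _.
by rewrite rmorphB /= map_polyX map_polyC /= mmapX mmap1U.
Qed.

(* With [l] the roots of [P] in some extension and [A] running over the sets
   of [b] roots, the products [\prod_(i in A) l i] are the roots of a monic
   polynomial [Theta] over [R] that reduces to ['X^N * ('X - c)], [c] being the
   product of the nonzero roots of [P] modulo [m].  Hence [c] lifts to a root
   of [Theta], which singles out the wanted set of roots. *)
Lemma hensel_factorization (P : {poly R}) (a b : nat) :
  P \is monic -> size P = (a + b).+1 ->
  (forall i, (i < a)%N -> m P`_i) -> ~ m P`_a ->
  exists g h : {poly R},
    [/\ g * h = P, forall i, m (g`_i - ('X^a)`_i) & ~ m h`_0].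
Proof.
move=> Pm sP Plow Pa.
(* [P1] stands for the reduction of [P]: it is congruent to [P] modulo [m], and its roots are
   explicit, namely [a] zeros and the roots [mu] of [u]. *)
pose u := drop_poly a P; pose P1 := u * 'X^a.
have PP1 i : m (P`_i - P1`_i).
  rewrite coefMXn coef_drop_poly; case: ltnP => ia; first by rewrite subr0; exact: Plow.
  by rewrite subnK // subrr; exact: ideal0.
have su : size u = b.+1 by rewrite size_drop_poly sP -addnS addKn.
have um : u \is monic.
  rewrite monicE lead_coefE su coef_drop_poly addnC.
  by move: Pm; rewrite monicE lead_coefE sP.
have [S1 [f1 [mu [f1i uE]]]] := monic_split um su.
have [S [f [l [fi PE]]]] := monic_split Pm sP.
pose l1 (i : 'I_(a + b)) := match split i with inl _ => 0 | inr j => mu j end.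
have P1E : splits f1 l1 P1.
  rewrite /splits /P1 rmorphM /= map_polyXn uE big_split_ord /= mulrC.
  rewrite -[a in 'X^a]card_ord -prodr_const; congr (_ * _).
    by apply: eq_bigr => i _; rewrite /l1 -/(unsplit (inl _)) unsplitK subr0.
  by apply: eq_bigr => i _; rewrite /l1 -/(unsplit (inr _)) unsplitK.
pose A0 : {set 'I_(a + b)} := [set rshift a j | j : 'I_b].
have cA0 : #|A0| == b.
  by rewrite card_imset ?card_ord //; exact: rshift_inj.
have [c cE cU] : exists2 c, \prod_j mu j = f1 c & ~ m c.
  exists ((-1) ^+ b * u`_0).
    rewrite rmorphM rmorphXn rmorphN1 -coef_map uE -horner_coef0 horner_prod.
    under [in RHS]eq_bigr do rewrite hornerXsubC sub0r.
    by rewrite prodrN card_ord mulrA -exprMn mulrNN mulr1 expr1n mul1r.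
  case/max_prime; last by rewrite coef_drop_poly.
  by apply: notin_maxX => h; apply: m1; rewrite -[1]opprK; apply: idealN.
pose th (A : {set 'I_(a + b)}) : {mpoly R[a + b]} := \prod_(i in A) 'X_i.
have thE (T : comNzRingType) (k : {rmorphism R -> T}) (r : 'I_(a + b) -> T) A :
    mmap k r (th A) = \prod_(i in A) r i.
  by rewrite rmorph_prod /=; apply: eq_bigr => i _; rewrite mmapX mmap1U.
pose t1 A := mmap f1 l1 (th A).
(* A set of [b] indices other than [A0] contains one of the first [a] indices, whose root is
   zero. *)
have t1E (A : {set 'I_(a + b)}) : #|A| == b -> t1 A = if A == A0 then f1 c else 0.
  move=> cA; rewrite /t1 thE; case: eqP => [->|/eqP nA].
    rewrite big_imset /=; last by move=> x y _ _; exact: rshift_inj.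
    rewrite -cE; apply: eq_bigr => i _.
    by rewrite /l1 -/(unsplit (inr _)) unsplitK.
  have : ~~ (A \subset A0).
    apply: contra nA => sA; rewrite eqEcard sA.
    by rewrite (eqP cA) (eqP cA0) leqnn.
  case/subsetPn => i iA iA0; rewrite (bigD1 i) //= /l1.
  case: splitP => [j _|j ij]; first by rewrite mul0r.
  by case/negP: iA0; apply/imsetP; exists j => //; exact: val_inj.
have thsym (s : 'S_(a + b)) A :
    map_poly (msym s) ('X - (th A)%:P) = 'X - (th (s @: A))%:P.
  by rewrite rmorphB /= map_polyX map_polyC /= msym_prod.
have [FT [FTE FTm]] := symmetric_poly_eval (prod_sets_symmetric b thsym).
pose Theta := FT P.
have ThE (T : comNzRingType) (k : {rmorphism R -> T}) r P' : splits k r P' ->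
    map_poly k (FT P') = \prod_(A : {set 'I_(a + b)} | #|A| == b)
        ('X - (mmap k r (th A))%:P).
  move=> sp; rewrite -(FTE _ _ _ _ sp) rmorph_prod /=; apply: eq_bigr => A _.
  by rewrite rmorphB /= map_polyX map_polyC.
have Thm : Theta \is monic.
  rewrite monicE -(inj_eq fi) -lead_coef_map_inj ?rmorph0 // (ThE _ _ _ _ PE).
  by rewrite rmorph1 -monicE; apply: monic_prod => A _; exact: monicXsubC.
pose N := #|[pred A : {set 'I_(a + b)} | (#|A| == b) && (A != A0)]|.
have Th1 : FT P1 = ('X - c%:P) * 'X^N.
  apply/polyP => i; apply: f1i; rewrite -!coef_map; congr (_ `_ i).
  rewrite (ThE _ _ _ _ P1E) (bigD1 A0) //= -/(t1 _) t1E // eqxx.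
  rewrite rmorphM rmorphB /= map_polyX map_polyC map_polyXn.
  rewrite (_ : \prod_(_ | _) _ = 'X^N) // /N -prodr_const.
  by apply: eq_bigr => A /andP[cA nA]; rewrite -/(t1 _) t1E // (negbTE nA) subr0.
have ThTh1 i : m (Theta`_i - (FT P1)`_i) by exact: FTm.
have m0 : m (c - c) by rewrite subrr; exact: ideal0.
have Thc : m Theta.[c].
  have := ideal_cong_horner idm ThTh1 m0.
  by rewrite Th1 hornerM hornerXsubC subrr mul0r subr0; apply.
have Thc' : ~ m Theta^`().[c].
  apply: (notin_max_cong (ideal_cong_horner idm (ideal_cong_deriv idm ThTh1) m0)).
  rewrite Th1 derivM derivXsubC mul1r hornerD hornerM hornerXsubC subrr mul0r.
  by rewrite addr0 hornerXn; exact: notin_maxX.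
have [th0 [th0r th0c]] := hens Thm Thc Thc'.
have /factor_theorem[Psi ThPsi] : root Theta th0 by apply/eqP.
pose dl := Psi.[th0].
have dlU : ~ m dl.
  have := ideal_cong_horner idm (ideal_cong_deriv idm ThTh1) th0c.
  have -> : Theta^`().[th0] = dl.
    rewrite ThPsi derivM derivXsubC mulr1 hornerD hornerM hornerXsubC subrr.
    by rewrite mulr0 add0r.
  rewrite Th1 derivM derivXsubC mul1r hornerD hornerM hornerXsubC subrr mul0r.
  by rewrite addr0 hornerXn => h; apply: (notin_max_cong h); exact: notin_maxX.
have [dl' dlE] := mU dlU.
(* Modulo [m], [Theta] vanishes at 0 as soon as some set besides [A0] exists, and its other factor
   takes there the unit value [- th0]. *)
have Psi0 : (0 < N)%N -> m Psi.[0].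
  move=> N0; have : m (0 - 0) by rewrite subrr; exact: ideal0.
  move/(ideal_cong_horner idm ThTh1).
  rewrite ThPsi Th1 !hornerM hornerXn expr0n gtn_eqF // mulr0 subr0.
  case/max_prime => //; rewrite hornerXsubC sub0r => h; case: cU.
  by rewrite -[c](subKr th0); apply: idealB => //; rewrite -[th0]opprK; apply: idealN.
(* The sum of the [K A] with weights [Psi.[th A]] is symmetric, so it descends to [R]. Modulo [m]
   only the weight of [A0] survives, with the unit value [dl]. *)
have key (K : {set 'I_(a + b)} -> {poly {mpoly R[a + b]}}) :
    (forall s A, map_poly (msym s) (K A) = K (s @: A)) ->
  exists F : {poly R},
    map_poly f F = \sum_(A : {set 'I_(a + b)} | #|A| == b)
      (map_poly f Psi).[mmap f l (th A)] *: map_poly (mmap f l) (K A) /\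
    forall k : {poly R}, map_poly f1 k = map_poly (mmap f1 l1) (K A0) ->
      forall i, m (F`_i - (dl *: k)`_i).
  move=> Ksym; pose psi A := (map_poly (@mpolyC _ R) Psi).[th A].
  have psiE (T : comNzRingType) (r : {rmorphism R -> T}) (x : 'I_(a + b) -> T) A :
      mmap r x (psi A) = (map_poly r Psi).[mmap r x (th A)].
    rewrite -horner_map -map_poly_comp; congr (_.[_]).
    by apply: eq_map_poly => y /=; rewrite mmapC.
  have psiK s A : map_poly (msym s) (psi A *: K A) = psi (s @: A) *: K (s @: A).
    by rewrite map_polyZ /= Ksym msym_horner msym_prod.
  have [F [FE Fm]] := symmetric_poly_eval (sum_sets_symmetric b psiK).
  have [F0 [F0E _]] := symmetric_poly_eval (sum_sets_symmetric b Ksym).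
  exists (F P); split.
    rewrite -(FE _ _ _ _ PE) raddf_sum; apply: eq_bigr => A _.
    by rewrite /= map_polyZ /= psiE.
  move=> k kE i.
  (* For the roots of [P1] all sets except [A0] have the same weight [Psi.[0]]; the unweighted sum
     [F0] gives their total contribution. *)
  have F1E : F P1 = Psi.[c] *: k + Psi.[0] *: (F0 P1 - k).
    apply/polyP => j; apply: f1i; rewrite -!coef_map; congr (_ `_ j).
    rewrite -(FE _ _ _ _ P1E) rmorphD /= !map_polyZ rmorphB /=.
    rewrite -(F0E _ _ _ _ P1E) kE !raddf_sum /= !(bigD1 A0 cA0) /=.
    rewrite [X in _ *: (X - _)]addrC addrK scaler_sumr map_polyZ /= psiE.
    rewrite -/(t1 _) t1E // eqxx horner_map.
    rewrite (eq_bigr (fun A => f1 Psi.[0] *: map_poly (mmap f1 l1) (K A))) //.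
    move=> A /andP[cA nA].
    rewrite map_polyZ /= psiE -/(t1 _) t1E // (negbTE nA).
    by rewrite -[0 in LHS](rmorph0 f1) horner_map.
  have F0k : N = 0%N -> F0 P1 = k.
    move=> N0; apply/polyP => j; apply: f1i; rewrite -!coef_map; congr (_ `_ j).
    rewrite -(F0E _ _ _ _ P1E) kE raddf_sum /= (bigD1 A0) //= big1 ?addr0 //.
    by move=> A hA; have /card0_eq/(_ A) := N0; rewrite inE hA.
  apply: (ideal_cong_trans idm (Fm _ _ _ idm PP1 i)); rewrite F1E !coefE.
  rewrite addrAC -mulrBl; apply: (idealD idm).
    apply: (ideal_mulr idm); apply: (ideal_cong_horner idm) => [j|].
      by rewrite subrr; exact: ideal0.
    by rewrite -opprB; apply: idealN.
  case: (posnP N) => [/F0k ->|/Psi0]; last exact: ideal_mulr.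
  by rewrite subrr mulr0; exact: ideal0.
have [|W [WE Wm]] := key (fun=> 1); first by move=> s A; rewrite rmorph1.
have [|H [HE Hm]] := key (@root_factor R _); first exact: msym_root_factor.
have [|G [GE Gm]] := key (fun A => root_factor R (~: A)).
  by move=> s A; rewrite msym_root_factor imsetC_perm.
pose Q := map_poly f Psi; pose t (A : {set 'I_(a + b)}) := mmap f l (th A).
have GHE : W * (G * H - dl ^+ 2 *: P) = 0.
  apply/polyP => i; apply: fi; rewrite -coef_map coef0 rmorph0.
  rewrite rmorphM rmorphB rmorphM /= map_polyZ rmorphXn WE GE HE /=.
  have -> : f dl = Q.[f th0] by rewrite horner_map.
  under eq_bigr do rewrite rmorph1; rewrite -scaler_suml -scalerAl mul1r.
  rewrite (symmetrized_factorization (d' := f dl')) ?coef0 //.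
  - by rewrite -(ThE _ _ _ _ PE) -/Theta ThPsi rmorphM rmorphB /= map_polyX
      map_polyC mulrC.
  - by rewrite horner_map -rmorphM dlE rmorph1.
  - move=> A _; rewrite PE !root_factor_mmap mulrC.
    rewrite [RHS](bigID (mem A)) /=; congr (_ * _).
    by apply: eq_bigl => i0; rewrite inE.
have W0U : ~ m W`_0.
  apply: (notin_max_cong (Wm 1 _ 0%N)); first by rewrite !rmorph1.
  by rewrite coefZ coef1 mulr1.
have WC : W = (W`_0)%:P.
  apply/polyP => i; rewrite coefC; case: eqP => [->//|/eqP i0].
  apply: fi; rewrite -coef_map WE rmorph0 coef_sum big1 // => A _.
  by rewrite rmorph1 coefZ coef1 (negbTE i0) mulr0.
have [w' wE] := mU W0U.
have GH : G * H = dl ^+ 2 *: P.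
  apply/eqP; rewrite -subr_eq0 -[_ - _]scale1r -wE mulrC -scalerA.
  by rewrite -[X in _ *: X]mul_polyC -WC GHE scaler0.
exists (dl' *: G), (dl' *: H); split.
- rewrite -scalerAl -scalerAr GH !scalerA -[RHS]scale1r; congr (_ *: _).
  by transitivity ((dl * dl') ^+ 2); [ring | rewrite dlE expr1n].
- move=> i; have := Gm 'X^a _ i; rewrite !coefZ => h.
  have -> : dl' * G`_i - 'X^a`_i = dl' * (G`_i - dl * 'X^a`_i).
    by rewrite mulrBr mulrA [dl' * dl]mulrC dlE mul1r.
  apply: ideal_mull => //; apply: h; rewrite map_polyXn root_factor_mmap.
  rewrite big_split_ord /= mulrC big1 ?mul1r => [|j]; last first.
    by rewrite inE => /negP[]; apply/imsetP; exists j.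
  rewrite -[a in LHS]card_ord -prodr_const; apply: eq_big => [j|j _].
    rewrite !inE; apply/esym/negP => /imsetP[k _ /(congr1 val) /= jk].
    by have := ltn_ord j; rewrite jk ltnNge leq_addr.
  by rewrite /l1 -/(unsplit (inl _)) unsplitK subr0.
- rewrite coefZ => h; have := Hm u _ 0%N; rewrite coefZ => Hu.
  have mH : m H`_0.
    rewrite -[H`_0]mul1r -dlE -mulrA; exact: ideal_mull.
  have [] // : ~ m (dl * u`_0).
    by case/max_prime => //; rewrite coef_drop_poly.
  rewrite -[dl * _](subKr H`_0); apply: idealB => //; apply: Hu.
  rewrite root_factor_mmap uE big_imset /=; last first.
    by move=> x y _ _; exact: rshift_inj.
  by apply: eq_bigr => i _; rewrite /l1 -/(unsplit (inr _)) unsplitK.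
Qed.
End HenselFactorization.

(** * Kernels, cokernels and free modules *)

Section Kernel.
Variables (R : comNzRingType) (X Y : lmodType R) (f : lhom X Y).

Definition ker_pred : {pred X} := fun x => f x == 0.

Fact ker_pred_closed : submod_closed ker_pred.
Proof.
split=> [|a x y /eqP fx /eqP fy]; rewrite -topredE /= /ker_pred ?linear0 //.
by rewrite linearP fx fy scaler0 addr0.
Qed.

HB.instance Definition _ :=
  GRing.isSubmodClosed.Build R X ker_pred ker_pred_closed.

Record kernel := Kernel { kernel_val : X; _ : kernel_val \in ker_pred }.

HB.instance Definition _ := [isSub for kernel_val].
HB.instance Definition _ := [Choice of kernel by <:].
HB.instance Definition _ := [SubChoice_isSubLmodule of kernel by <:].

End Kernel.

Section Cokernel.
Variables (R : comNzRingType) (X Y : lmodType R) (f : lhom X Y).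

Definition im_pred : {pred Y} := fun y => `[< exists x, f x = y >].

Fact im_pred_closed : zmod_closed im_pred.
Proof.
split=> [|_ _ /asboolP[x <-] /asboolP[x' <-]]; apply/asboolP.
  by exists 0; rewrite linear0.
by exists (x - x'); rewrite linearB.
Qed.

HB.instance Definition _ := GRing.isZmodClosed.Build Y im_pred im_pred_closed.

Definition cokernel := Quotient.quot im_pred.
HB.instance Definition _ := GRing.Zmodule.on cokernel.

Definition cok_class (y : Y) : cokernel := (\pi_(Quotient.quot im_pred) y)%qT.

Lemma cok_classP y y' : cok_class y = cok_class y' <-> exists x, f x = y - y'.
Proof.
rewrite -(asboolE (exists _, _)).
rewrite -[X in _ <-> is_true X]/((y - y') \in im_pred) Quotient.idealrBE.
by split=> /eqP.
Qed.

Lemma cok_classD y y' : cok_class (y + y') = cok_class y + cok_class y'.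
Proof. by rewrite /cok_class !piE. Qed.

Lemma cok_class_surj (z : cokernel) : exists y, cok_class y = z.
Proof. exists (repr (z : Quotient.quot im_pred)); exact: reprK. Qed.

Definition cok_scale (a : R) (z : cokernel) : cokernel :=
  cok_class (a *: repr (z : Quotient.quot im_pred)).

Lemma cok_scaleE a y : cok_scale a (cok_class y) = cok_class (a *: y).
Proof.
have /cok_classP[x xE] : cok_class (repr (cok_class y)) = cok_class y.
  exact: reprK.
by apply/cok_classP; exists (a *: x); rewrite linearZ /= xE scalerBr.
Qed.

Fact cok_scaleA a b z : cok_scale a (cok_scale b z) = cok_scale (a * b) z.
Proof. by have [y <-] := cok_class_surj z; rewrite !cok_scaleE scalerA. Qed.
Fact cok_scale1 : left_id 1 cok_scale.
Proof. by move=> z; have [y <-] := cok_class_surj z; rewrite cok_scaleE scale1r. Qed.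
Fact cok_scaleDr : right_distributive cok_scale +%R.
Proof.
move=> a z z'; have [y <-] := cok_class_surj z; have [y' <-] := cok_class_surj z'.
by rewrite -cok_classD !cok_scaleE -cok_classD scalerDr.
Qed.
Fact cok_scaleDl z : {morph cok_scale^~ z : a b / a + b}.
Proof.
move=> a b; have [y <-] := cok_class_surj z.
by rewrite /= !cok_scaleE -cok_classD scalerDl.
Qed.

HB.instance Definition _ := GRing.Zmodule_isLmodule.Build R cokernel
  cok_scaleA cok_scale1 cok_scaleDr cok_scaleDl.

Fact cok_class_linear : linear cok_class.
Proof. by move=> a x y; rewrite cok_classD; congr (_ + _); rewrite -cok_scaleE. Qed.

End Cokernel.

Section Linear.
Variable R : comNzRingType.
Implicit Types X Y Z W P Q K : lmodType R.

Definition mkhom X Y (f : X -> Y) (lf : linear f) : lhom X Y :=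
  HB.pack_for {linear X -> Y} f (GRing.isLinear.Build R X Y _ f lf).

Definition hcomp X Y Z (g : lhom Y Z) (f : lhom X Y) : lhom X Z := g \o f.
Definition hid X : lhom X X := idfun.

Lemma kernel_exists X Y (f : lhom X Y) :
  exists K (i : lhom K X), injective i /\ exact_at i f.
Proof.
have lf : linear (val : kernel f -> X) by [].
exists (kernel f : lmodType R), (mkhom lf); split; first exact: val_inj.
move=> x; split=> [fx|[k <-]].
  have xk : x \in ker_pred f by apply/eqP.
  by exists (Kernel xk).
by case: k => k /= /eqP.
Qed.

Lemma cokernel_exists X Y (f : lhom X Y) :
  exists Q (q : lhom Y Q), surjective_map q /\ exact_at f q.
Proof.
exists (cokernel f : lmodType R), (mkhom (@cok_class_linear R X Y f)).
split; first exact: cok_class_surj.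
move=> y /=; rewrite -[X in _ = X](linear0 (mkhom (@cok_class_linear R X Y f))) /=.
by rewrite cok_classP subr0.
Qed.

Lemma lift_mono W K X (i : lhom K X) (g : lhom W X) :
  injective i -> (forall w, exists k, i k = g w) ->
  exists h : lhom W K, forall w, i (h w) = g w.
Proof.
move=> inj /choice[h hE].
have lh : linear h by move=> a x y; apply: inj; rewrite !linearP !hE linearP.
by exists (mkhom lh).
Qed.

Lemma factor_epi X Q Y (q : lhom X Q) (g : lhom X Y) :
  surjective_map q -> (forall x, q x = 0 -> g x = 0) ->
  exists h : lhom Q Y, forall x, h (q x) = g x.
Proof.
move=> /choice[s sE] qg.
have gs x : g (s (q x)) = g x.
  by apply/eqP; rewrite -subr_eq0 -linearB; apply/eqP/qg; rewrite linearB sE subrr.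
have lh : linear (g \o s).
  move=> a x y /=; rewrite -[x in LHS]sE -[y in LHS]sE -linearP gs.
  by rewrite linearP.
by exists (mkhom lh).
Qed.

Lemma bij_inverse X Y (f : lhom X Y) : injective f -> surjective_map f ->
  exists g : lhom Y X, cancel f g /\ cancel g f.
Proof.
move=> inj surj; have [y|g gE] := @lift_mono Y X Y f (hid Y) inj.
  exact: surj.
by exists g; split=> // x; apply: inj; rewrite gE.
Qed.

Lemma inj0 X Y (f : lhom X Y) : (forall x, f x = 0 -> x = 0) -> injective f.
Proof.
move=> h x y xy; apply/eqP; rewrite -subr_eq0; apply/eqP/h.
by rewrite linearB xy subrr.
Qed.

Fact pairh_linear W X Y (f : lhom W X) (g : lhom W Y) :
  linear (fun w => (f w, g w)).
Proof. by move=> a x y; rewrite !linearP. Qed.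
Definition pairh W X Y (f : lhom W X) (g : lhom W Y) : lhom W (X * Y)%type :=
  mkhom (pairh_linear f g).
Definition copairh X Y Z (f : lhom X Z) (g : lhom Y Z) : lhom (X * Y)%type Z :=
  (f \o fst) \+ (g \o snd).
Definition inlh X Y : lhom X (X * Y)%type := pairh (hid X) (lhom0 X Y).
Definition inrh X Y : lhom Y (X * Y)%type := pairh (lhom0 Y X) (hid Y).
Definition fsth X Y : lhom (X * Y)%type X := fst.
Definition sndh X Y : lhom (X * Y)%type Y := snd.

Fact combh_linear n X (g : 'I_n -> X) :
  linear (fun v : 'rV[R]_n => \sum_i v 0 i *: g i).
Proof.
move=> a x y; rewrite scaler_sumr -big_split; apply: eq_bigr => i _ /=.
by rewrite !mxE scalerDl scalerA.
Qed.
Definition combh n X (g : 'I_n -> X) : lhom 'rV[R]_n X :=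
  mkhom (combh_linear g).

Lemma row_combh n X (h : lhom 'rV[R]_n X) v :
  h v = \sum_i v 0 i *: h (delta_mx 0 i).
Proof.
rewrite {1}[v]row_sum_delta linear_sum; apply: eq_bigr => i _.
exact: linearZ.
Qed.

Lemma free_projective n : projective ('rV[R]_n : lmodType R).
Proof.
move=> Y Z g h gs; have [y yE] := choice (fun i => gs (h (delta_mx 0 i))).
exists (combh y) => v; rewrite [RHS]row_combh /= linear_sum.
by apply: eq_bigr => i _; rewrite linearZ /= yE.
Qed.

Lemma free_fingen n : fingen ('rV[R]_n : lmodType R).
Proof.
exists n, (delta_mx 0) => v; exists (v 0); exact: row_sum_delta.
Qed.

Lemma free_cover X : fingen X ->
  exists n (p : lhom 'rV[R]_n X), surjective_map p.
Proof.
move=> [n [g gE]]; exists n, (combh g) => x; have [c ->] := gE x.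
by exists (\row_i c i) => /=; apply: eq_bigr => i _; rewrite mxE.
Qed.

Lemma fingen_surj X Y (f : lhom X Y) : surjective_map f -> fingen X -> fingen Y.
Proof.
move=> fs [n [g gE]]; exists n, (f \o g) => y; have [x <-] := fs y.
have [c ->] := gE x; exists c; rewrite linear_sum.
by apply: eq_bigr => i _; rewrite linearZ.
Qed.

Lemma fingen_ext X Y Z (f : lhom X Y) (g : lhom Y Z) :
  exact_at f g -> surjective_map g -> fingen X -> fingen Z -> fingen Y.
Proof.
move=> ex gs [n [u uE]] [k [v vE]].
have [w wE] := choice (fun i => gs (v i)).
exists (n + k)%N, (fun i => match split i with inl j => f (u j) | inr j => w j end).
move=> y; have [d dE] := vE (g y).
have /ex[x xE] : g (y - \sum_j d j *: w j) = 0.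
  apply/eqP; rewrite linearB linear_sum dE subr_eq0.
  by apply/eqP/eq_bigr => j _; rewrite linearZ /= wE.
have [c cE] := uE x.
exists (fun i => match split i with inl j => c j | inr j => d j end).
rewrite big_split_ord /=.
under eq_bigr do rewrite -/(unsplit (inl _)) unsplitK.
under [X in _ + X]eq_bigr do rewrite -/(unsplit (inr _)) unsplitK.
rewrite -[LHS](subrK (\sum_j d j *: w j)) -xE cE; congr (_ + _).
by rewrite linear_sum; apply: eq_bigr => i _; rewrite linearZ.
Qed.

Lemma fingen_prod X Y : fingen X -> fingen Y -> fingen (X * Y)%type.
Proof.
move=> fX fY; apply: (fingen_ext (f := @inlh X Y) (g := @sndh X Y)) => //.
  move=> [x y] /=; split=> [->|[x' [_ <-//]]]; by exists x.
by move=> y; exists (0, y).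
Qed.

End Linear.

(** * Noetherian modules and the Fitting decomposition *)

Section Noetherian.
Variable R : comNzRingType.
Hypothesis noethR : noetherian R.
Implicit Types X Y Z W : lmodType R.

Definition submodule X (N : X -> Prop) : Prop :=
  N 0 /\ forall a x y, N x -> N y -> N (a *: x + y).

Lemma submodule_sum X (N : X -> Prop) n (c : 'I_n -> R) (g : 'I_n -> X) :
  submodule N -> (forall i, N (g i)) -> N (\sum_i c i *: g i).
Proof.
move=> [N0 NP] Ng; elim/big_ind: _ => // [x y Nx Ny|i _].
  by rewrite -[x]scale1r; apply: NP.
by rewrite -[_ *: _]addr0; apply: NP.
Qed.

Definition finite_submodule X (N : X -> Prop) : Prop :=
  exists n (g : 'I_n -> X), (forall i, N (g i)) /\
    forall x, N x -> exists c : 'I_n -> R, x = \sum_i c i *: g i.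

(** The coefficients at [g ord0] of elements of [N] form a finitely generated ideal; subtracting
    lifts of its generators leaves the span of the other [g i]. Only the elements of [N] are
    required to be spanned, so the induction stays inside the same [X]. *)
Lemma noetherian_span X n (g : 'I_n -> X) (N : X -> Prop) : submodule N ->
  (forall x, N x -> exists c : 'I_n -> R, x = \sum_i c i *: g i) ->
  finite_submodule N.
Proof.
elim: n g N => [|n IH] g N sN span.
  exists 0%N, (fun=> 0); split=> [[]//|x /span[c ->]].
  by exists c; rewrite !big_ord0.
pose I (a : R) := exists c : 'I_n.+1 -> R, c ord0 = a /\ N (\sum_i c i *: g i).
have idI : ideal I.
  have [N0 NP] := sN; split.
  - exists (fun=> 0); split=> //; rewrite big1 // => i _; exact: scale0r.
  - move=> x y [c [<- Nc]] [d [<- Nd]]; exists (fun i => c i + d i); split=> //.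
    under eq_bigr do rewrite scalerDl; rewrite big_split /= -[X in X + _]scale1r.
    exact: NP.
  - move=> a x [c [<- Nc]]; exists (fun i => a * c i); split=> //.
    under eq_bigr do rewrite -scalerA; rewrite -scaler_sumr -[_ *: _]addr0.
    exact: NP.
have [k [a aE]] := noethR idI.
have aI j : I (a j).
  apply/aE; exists (fun i => (i == j)%:R); rewrite (bigD1 j) //= eqxx mul1r.
  by rewrite big1 ?addr0 // => i /negbTE ->; rewrite mul0r.
have [d dE] := choice aI.
pose z j := \sum_i d j i *: g i.
pose N' x := N x /\ exists c : 'I_n -> R, x = \sum_i c i *: g (lift ord0 i).
have [||l [w [wN wE]]] := IH (g \o lift ord0) N'.
- have [N0 NP] := sN; split.
    split=> //; exists (fun=> 0); rewrite big1 // => i _; exact: scale0r.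
  move=> b x y [Nx [c cE]] [Ny [e eE]]; split; first exact: NP.
  exists (fun i => b * c i + e i); rewrite cE eE scaler_sumr -big_split.
  by apply: eq_bigr => i _; rewrite scalerDl scalerA.
- by move=> x [_ []] c ->; exists c.
exists (k + l)%N, (fun i => match split i with inl j => z j | inr j => w j end).
split=> [i|x Nx].
  by case: (split i) => j; [exact: (proj2 (dE j)) | exact: (proj1 (wN j))].
have [c cE] := span x Nx.
have /aE[b bE] : I (c ord0) by exists c; rewrite -cE.
have [|e eE] := wE (x - \sum_j b j *: z j).
  split.
    rewrite addrC -scaleN1r; have [_ NP] := sN; apply: NP => //.
    by apply: submodule_sum => // j; exact: (proj2 (dE j)).
  exists (fun i => c (lift ord0 i) - \sum_j b j * d j (lift ord0 i)).
  rewrite cE big_ord_recl bE /=.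
  have -> : \sum_j b j *: z j = (\sum_j b j * a j) *: g ord0 +
      \sum_i (\sum_j b j * d j (lift ord0 i)) *: g (lift ord0 i).
    under [X in _ + X]eq_bigr do rewrite scaler_suml.
    rewrite scaler_suml exchange_big -big_split; apply: eq_bigr => j _ /=.
    rewrite /z big_ord_recl scalerDr scalerA scaler_sumr (proj1 (dE j)); congr (_ + _).
    by apply: eq_bigr => i _; rewrite scalerA.
  rewrite opprD addrACA subrr add0r -sumrB; apply: eq_bigr => i _; by rewrite scalerBl.
exists (fun i => match split i with inl j => b j | inr j => e j end).
rewrite big_split_ord /=.
under eq_bigr do rewrite -/(unsplit (inl _)) unsplitK.
under [X in _ + X]eq_bigr do rewrite -/(unsplit (inr _)) unsplitK.
by rewrite -eE subrKC.
Qed.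

Lemma noetherian_submodule X (N : X -> Prop) :
  fingen X -> submodule N -> finite_submodule N.
Proof.
by move=> [n [g gE]] sN; apply: (@noetherian_span _ n g) => // x _; exact: gE.
Qed.

Lemma fingen_sub K X (i : lhom K X) : injective i -> fingen X -> fingen K.
Proof.
move=> inj fX; pose N x := exists k, i k = x.
have [|n [g [gN gE]]] := noetherian_submodule (N := N) fX.
  split=> [|a _ _ [k <-] [l <-]]; first by exists 0; rewrite linear0.
  by exists (a *: k + l); rewrite linearP.
have [h hE] := choice gN; exists n, h => k.
have [|c cE] := gE (i k); first by exists k.
exists c; apply: inj; rewrite cE linear_sum; apply: eq_bigr => j _.
by rewrite linearZ /= hE.
Qed.

(** Otherwise dependent choice builds a strictly increasing chain; its union is finitely generated,
    hence already reached at a finite stage. *)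
Lemma noetherian_max X (F : (X -> Prop) -> Prop) N0 : fingen X ->
  (forall N, F N -> submodule N) -> F N0 ->
  exists N, F N /\ forall M, F M -> (forall x, N x -> M x) -> forall x, M x -> N x.
Proof.
move=> fX Fs FN0; apply: contrapT => /forallNP none.
have next (N : {N | F N}) : exists M : {N | F N},
    (forall x, sval N x -> sval M x) /\ exists x, sval M x /\ ~ sval N x.
  case: N => N FN /=; have /not_andP[//|/existsNP[M]] := none N.
  move=> /not_implyP[FM /not_implyP[NM /existsNP[x /not_implyP[Mx Nx]]]].
  by exists (exist _ M FM); split=> //; exists x.
have [nx nxE] := choice next.
pose s k := iter k nx (exist _ N0 FN0).
have mono j k : (j <= k)%N -> forall x, sval (s j) x -> sval (s k) x.
  move=> /subnK <-; elim: (k - j)%N => // i IH x /IH.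
  by rewrite addSn; have [h _] := nxE (s (i + j)%N); exact: h.
have [|n [g [gN gE]]] := noetherian_submodule (N := fun x => exists k, sval (s k) x) fX.
  split=> [|a x y [k kx] [l ly]].
    by exists 0%N; have [] := Fs _ FN0.
  exists (maxn k l); have [_ h] := Fs _ (svalP (s (maxn k l))).
  by apply: h; [apply: mono kx; exact: leq_maxl | apply: mono ly; exact: leq_maxr].
have [k kE] := choice gN; pose K := (\max_i k i)%N.
have [_ [x [Mx]]] := nxE (s K); apply.
have [|c ->] := gE x; first by exists K.+1.
apply: submodule_sum; first exact: Fs (svalP (s K)).
by move=> i; apply: mono (kE i); exact: leq_bigmax.
Qed.

Lemma surj_endo_inj X (f : lhom X X) : fingen X -> surjective_map f -> injective f.
Proof.
move=> fX fs; pose kn k x := iter k f x = 0.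
have it0 k : iter k f 0 = 0 by elim: k => //= k ->; exact: linear0.
have itP k a x y : iter k f (a *: x + y) = a *: iter k f x + iter k f y.
  by elim: k => //= k ->; exact: linearP.
have [||_ [[k ->] kmax]] := noetherian_max (F := fun N => exists k, N = kn k)
  (N0 := kn 0%N) fX.
- move=> _ [k ->]; split=> [|a x y]; rewrite /kn ?it0 // itP => -> ->.
  by rewrite scaler0 addr0.
- by exists 0%N.
have its : surjective_map (iter k f).
  by elim: k {kmax} => [|k IH] y; [exists y | have [z <-] := fs y; have [w <-] := IH z; exists w].
(* The kernels of the iterates are stationary from [k] on. Writing [x] as the [k]-th iterate at [y]
   puts [y] in the next kernel, hence in the [k]-th, so [x = 0]. *)
apply: inj0 => x fx; have [y yE] := its x.
have /kmax h : exists l, kn k.+1 = kn l by exists k.+1.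
rewrite -yE; apply: h; last by rewrite /kn iterS yE.
by move=> z zk; rewrite /kn iterS zk linear0.
Qed.

End Noetherian.

(** Elements outside [m] are units: a nonunit lies in an ideal maximal among the proper ones, which
    exists by noetherianity and is [m] by uniqueness. *)
Lemma local_facts (R : comNzRingType) : noetherian R -> henselian_local R ->
  exists m : R -> Prop, [/\ ideal m, ~ m 1, forall x, ~ m x -> exists y, x * y = 1 &
   forall (p : {poly R}) (a : R), p \is monic -> m p.[a] -> ~ m p^`().[a] ->
     exists b, p.[b] = 0 /\ m (b - a)].
Proof.
move=> nR [[m [mmax muniq]] hens]; exists m; have [idm m1 _] := mmax.
split=> //; last by move=> p a; exact: hens.
move=> x mx; apply: contrapT => xU; apply: mx.
pose X0 (a : R) := exists y, a = x * y.
pose F (I : R^o -> Prop) := [/\ ideal I, ~ I 1 & forall y, X0 y -> I y].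
have subI (I : R -> Prop) : ideal I -> @submodule R R^o I.
  move=> [I0 ID IM]; split=> // a y z Iy Iz; apply: (ID _ _ _ Iz); exact: IM.
have [|||I [[idI I1 IX] Imax]] := noetherian_max nR (X := R^o) (F := F) (N0 := X0).
- exists 1%N, (fun=> 1) => y; exists (fun=> y); rewrite big_ord1.
  by rewrite /GRing.scale /= mulr1.
- by move=> I [+ _ _]; exact: subI.
- split=> //; last by move=> [y yE]; apply: xU; exists y.
  split; first by exists 0; rewrite mulr0.
    by move=> _ _ [y ->] [z ->]; exists (y + z); rewrite mulrDr.
  by move=> a _ [y ->]; exists (a * y); rewrite mulrCA.
have -> : m = I.
  apply: muniq; split=> // J idJ J1 IJ; apply/funext => y; apply/propext.
  split; last exact: IJ.
  by apply: Imax => //; split=> // z /IX; exact: IJ.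
by apply: IX; exists 1; rewrite mulr1.
Qed.

(** * Nakayama's lemma and polynomials in an endomorphism *)

Section Local.
Variables (R : comNzRingType) (m : R -> Prop).
Hypotheses (idm : ideal m) (m1 : ~ m 1).
Hypothesis mU : forall x, ~ m x -> exists y, x * y = 1.
Implicit Types X Y Z W : lmodType R.

Lemma one_sub_unit c : m c -> exists u, u * (1 - c) = 1.
Proof.
move=> mc; have [|u uE] := mU (x := 1 - c).
  by move=> h; apply: m1; rewrite -[1](subrK c); apply: idealD.
by exists u; rewrite mulrC.
Qed.

(** Gaussian elimination: [1 - c0 ord0] is a unit, so the relation for [g ord0] can be solved and
    substituted into the others, whose coefficients stay in [m]. *)
Lemma nakayama X n (g : 'I_n -> X) (N : X -> Prop) : submodule N ->
  (forall i, exists x (c : 'I_n -> R), [/\ N x, forall j, m (c j) &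
     g i = x + \sum_j c j *: g j]) -> forall i, N (g i).
Proof.
move=> sN; have [N0 NP] := sN.
have ND x y : N x -> N y -> N (x + y) by move=> *; rewrite -[x]scale1r; apply: NP.
have NZ a x : N x -> N (a *: x) by move=> *; rewrite -[_ *: _]addr0; apply: NP.
elim: n g => [|n IH] g h; first by case.
have [x0 [c0 [Nx0 mc0 g0E]]] := h ord0.
have [u uE] := one_sub_unit (mc0 ord0).
have {}g0E : g ord0 = u *: x0 + \sum_j (u * c0 (lift ord0 j)) *: g (lift ord0 j).
  rewrite -[LHS]scale1r -uE -scalerA scalerBl scale1r {1}g0E big_ord_recl.
  rewrite addrCA addrAC subrr add0r scalerDr scaler_sumr; congr (_ + _).
  by apply: eq_bigr => j _; rewrite scalerA.
have Ng i : N (g (lift ord0 i)).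
  apply: (IH (fun i => g (lift ord0 i))) => j.
  have [x [c [Nx mc gE]]] := h (lift ord0 j).
  exists (x + c ord0 *: (u *: x0)),
    (fun k => c (lift ord0 k) + c ord0 * (u * c0 (lift ord0 k))); split.
  - by apply: ND => //; apply/NZ/NZ.
  - by move=> k; apply: (idealD idm) => //; apply: (ideal_mulr idm).
  rewrite gE big_ord_recl {1}g0E scalerDr -!addrA; congr (_ + (_ + _)).
  rewrite scaler_sumr addrC -big_split; apply: eq_bigr => k _ /=.
  by rewrite scalerDl !scalerA.
move=> i; case: (unliftP ord0 i) => [j ->//|->]; rewrite g0E.
by apply: ND; [exact: NZ | exact: submodule_sum].
Qed.

Definition in_mX X (x : X) : Prop :=
  exists k (c : 'I_k -> R) (y : 'I_k -> X), (forall j, m (c j)) /\ x = \sum_j c j *: y j.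

Lemma nakayama_surj W X (f : lhom W X) : fingen X ->
  (forall x, exists w y, in_mX y /\ x = f w + y) -> surjective_map f.
Proof.
move=> [n [g gE]] h; pose N x := exists w, f w = x.
have sN : submodule N.
  split=> [|a _ _ [x <-] [y <-]]; first by exists 0; rewrite linear0.
  by exists (a *: x + y); rewrite linearP.
have Ng : forall i, N (g i).
  apply: nakayama => // i; have [w [_ [[k [c [y [mc ->]]]] giE]]] := h (g i).
  have [d dE] := choice (fun j => gE (y j)).
  exists (f w), (fun i => \sum_j c j * d j i); split; first by exists w.
    by move=> j; apply: (ideal_sum idm) => l _; apply: (ideal_mulr idm).
  rewrite giE; congr (_ + _); under [RHS]eq_bigr do rewrite scaler_suml.
  rewrite exchange_big; apply: eq_bigr => j _ /=.
  by rewrite {1}dE scaler_sumr; apply: eq_bigr => l _; rewrite scalerA.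
by move=> x; have [c ->] := gE x; apply: (submodule_sum _ sN).
Qed.

Section EndoPoly.
Variables (X : lmodType R) (e : lhom X X).

(** The action of [R[X]] on [X] in which the variable acts as [e]. *)
Definition pev (p : {poly R}) (x : X) : X := \sum_(i < size p) p`_i *: iter i e x.

Lemma pev_wide n (p : {poly R}) x : (size p <= n)%N -> pev p x = \sum_(i < n) p`_i *: iter i e x.
Proof.
move=> sp; rewrite /pev (big_ord_widen n (fun i => p`_i *: iter i e x)) //.
rewrite big_mkcond; apply: eq_bigr => i _; case: ltnP => // h.
by rewrite nth_default ?scale0r.
Qed.

Lemma pev_linear p : linear (pev p).
Proof.
move=> a x y; rewrite /pev scaler_sumr -big_split; apply: eq_bigr => i _ /=.
have -> : iter i e (a *: x + y) = a *: iter i e x + iter i e y.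
  by elim: (i : nat) => //= k ->; exact: linearP.
by rewrite scalerDr !scalerA mulrC.
Qed.

Definition pevh p : lhom X X := mkhom (pev_linear p).

Lemma pevD p q x : pev (p + q) x = pev p x + pev q x.
Proof.
pose n := maxn (size p) (size q).
rewrite !(@pev_wide n) ?leq_maxl ?leq_maxr ?size_polyD // -big_split.
by apply: eq_bigr => i _; rewrite coefD scalerDl.
Qed.

Lemma pevC c x : pev c%:P x = c *: x.
Proof. by rewrite (@pev_wide 1) ?size_polyC_leq1 // big_ord1 coefC. Qed.

Lemma pevZ c p x : pev (c *: p) x = c *: pev p x.
Proof.
rewrite !(@pev_wide (size p)) ?size_scale_leq // scaler_sumr.
by apply: eq_bigr => i _; rewrite coefZ scalerA.
Qed.

Lemma pev_mulX (p : {poly R}) x : pev (p * 'X) x = pev p (e x).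
Proof.
have sp : (size (p * 'X)%R <= (size p).+1)%N.
  by apply: (leq_trans (size_polyMleq _ _)); rewrite size_polyX addn2.
rewrite (pev_wide x sp) big_ord_recl coefMX eqxx scale0r add0r.
by apply: eq_bigr => i _; rewrite coefMX lift0 iterSr.
Qed.

Lemma pev_Xmul (p : {poly R}) x : pev ('X * p) x = e (pev p x).
Proof.
rewrite mulrC pev_mulX /pev linear_sum; apply: eq_bigr => i _.
by rewrite -iterSr linearZ.
Qed.

Lemma pevM p q x : pev (p * q) x = pev p (pev q x).
Proof.
elim/poly_ind: p q => [|p c IH] q.
  by rewrite mul0r -polyC0 !pevC !scale0r.
rewrite mulrDl -mulrA !pevD IH pev_Xmul pev_mulX; congr (_ + _).
by rewrite mul_polyC pevZ pevC.
Qed.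

Lemma pev1 x : pev 1 x = x. Proof. by rewrite -polyC1 pevC scale1r. Qed.

Lemma pevN p x : pev (- p) x = - pev p x.
Proof. by apply: (addIr (pev p x)); rewrite -pevD !addNr -polyC0 pevC scale0r. Qed.
Lemma cayley_hamilton_module : fingen X ->
  exists p n, [/\ p \is monic, size p = n.+1 & forall x, pev p x = 0].
Proof.
(* A zero generator is added so that the square matrices form a nontrivial ring. *)
move=> fX; have [n [g gE]] : exists n (g : 'I_n.+1 -> X),
    forall x, exists c : 'I_n.+1 -> R, x = \sum_i c i *: g i.
  have [n [g gE]] := fX; exists n, (fun i => oapp g 0 (unlift ord0 i)) => x.
  have [c ->] := gE x; exists (fun i => oapp c 0 (unlift ord0 i)).
  rewrite big_ord_recl unlift_none scaler0 add0r.
  by apply: eq_bigr => i _; rewrite liftK.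
have [a aE] := choice (fun i => gE (e (g i))).
pose A : 'M[R]_n.+1 := \matrix_(i, j) a i j.
have eA (v : 'rV_n.+1) : e (combh g v) = combh g (v *m A).
  rewrite /= linear_sum; under [RHS]eq_bigr do rewrite mxE scaler_suml.
  rewrite exchange_big; apply: eq_bigr => i _ /=.
  rewrite linearZ /= aE scaler_sumr; apply: eq_bigr => j _.
  by rewrite scalerA !mxE.
have pA p v : pev p (combh g v) = combh g (v *m horner_mx A p).
  elim/poly_ind: p v => [|p c IH] v.
    by rewrite rmorph0 mulmx0 linear0 -polyC0 pevC scale0r.
  have -> : horner_mx A (p * 'X + c%:P) = A *m horner_mx A p + c%:M.
    rewrite rmorphD rmorphM /= horner_mx_X horner_mx_C -mulmxE.
    by rewrite (comm_horner_mx _ (comm_mx_refl A)).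
  rewrite pevD pev_mulX pevC eA IH mulmxDr [RHS]linearD mulmxA.
  by rewrite mul_mx_scalar [combh g (c *: v)]linearZ.
exists (char_poly A), n.+1; split; rewrite ?char_poly_monic ?size_char_poly //.
move=> x; have [c ->] := gE x.
have -> : \sum_i c i *: g i = combh g (\row_i c i).
  by apply: eq_bigr => i _; rewrite mxE.
by rewrite pA Cayley_Hamilton mulmx0 linear0.
Qed.

End EndoPoly.

End Local.

Section Fitting.
Variable R : comNzRingType.
Hypotheses (noethR : noetherian R) (henselR : henselian_local R).

Lemma pev_in_mX (m : R -> Prop) (X : lmodType R) (e : lhom X X) (p : {poly R}) x :
  (forall i, m p`_i) -> in_mX m (pev e p x).
Proof. by move=> mp; exists (size p), (fun i => p`_i), (fun i => iter i e x). Qed.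

Lemma pev_at0 (X : lmodType R) (e : lhom X X) p : pev e p 0 = 0.
Proof. exact: (linear0 (pevh e p)). Qed.

Lemma geometric_sum (y : {poly R}) a :
  (1 - y) * \sum_(i < a) y ^+ i = 1 - y ^+ a.
Proof. by rewrite -[LHS]opprK -mulNr opprB -subrX1 opprB. Qed.

Lemma fitting (X : lmodType R) (e : lhom X X) : fingen X ->
  exists f c d : lhom X X, [/\ forall x, f (f x) = f x,
    forall x, c (e (f x)) = f x &
    forall x, d (x - f x - e (x - f x)) = x - f x].
Proof.
move=> fX; have [m [idm m1 mU hens]] := local_facts noethR henselR.
have [P [n [Pm sP P0]]] := cayley_hamilton_module e fX.
have exP : exists i, `[< ~ m P`_i >].
  by exists n; apply/asboolP; move: Pm; rewrite monicE lead_coefE sP /= => /eqP ->.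
have [a /asboolP Pa amin] := ex_minnP exP.
have an : (a <= n)%N.
  apply: amin; apply/asboolP; move: Pm.
  by rewrite monicE lead_coefE sP /= => /eqP ->.
have [||g [h [ghP gX h0]]] :=
    hensel_factorization idm m1 mU hens (a := a) (b := (n - a)%N) Pm _ _ Pa.
- by rewrite subnKC.
- move=> i ia; apply: contrapT => mi.
  by have := amin i; rewrite leqNgt ia => /(_ (introT (asboolP _) mi)).
have [s sE] := mU _ h0.
pose k := - (s *: drop_poly 1 h).
have hk : s *: h = 1 - k * 'X.
  rewrite /k mulNr opprK -{1}[h](poly_take_drop 1) expr1 scalerDr -scalerAl.
  congr (_ + _); apply/polyP => i; rewrite coefZ coef_take_poly coef1.
  by case: i => [|i]; rewrite ?mulr0 //= mulrC sE.
pose v := s *: \sum_(i < a) (k * 'X) ^+ i; pose u := k ^+ a.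
(* [u * g + v * h] reduces to 1, so it acts bijectively on [X]. *)
pose mu := u * (g - 'X^a).
have uvE : u * g + v * h = 1 + mu.
  rewrite /mu mulrBr addrCA; congr (_ + _).
  by rewrite /v -scalerAl scalerAr hk mulrC geometric_sum exprMn.
have mmu i : m mu`_i.
  rewrite coefM; apply: (ideal_sum idm) => j _; apply: (ideal_mull idm).
  by rewrite coefB; exact: gX.
have [om' [omK om'K]] : exists g : lhom X X,
    cancel (pevh e (1 + mu)) g /\ cancel g (pevh e (1 + mu)).
  have os : surjective_map (pevh e (1 + mu)).
    apply: (nakayama_surj idm m1 mU) fX _ => x; exists x, (pev e (- mu) x).
    split; first by apply: pev_in_mX => i; rewrite coefN; exact: idealN.
    by rewrite /= -pevD addrK pev1.
  by apply: bij_inverse => //; exact: (surj_endo_inj noethR).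
have omC p x : om' (pev e p x) = pev e p (om' x).
  by rewrite -{1}[x]om'K /= -pevM mulrC pevM -[pev e (1 + mu) _]/(pevh e _ _) omK.
pose F x := pev e (v * h) (om' x); pose F' x := pev e (u * g) (om' x).
have FF' x : F x + F' x = x.
  by rewrite /F /F' -pevD addrC uvE; exact: om'K.
have gF x : pev e g (F x) = 0.
  by rewrite /F -pevM mulrCA ghP pevM P0 pev_at0.
have hF' x : pev e h (F' x) = 0.
  by rewrite /F' -pevM mulrCA [h * g]mulrC ghP pevM P0 pev_at0.
have FF0 x : F (F' x) = 0.
  have vu : v * h * (u * g) = v * u * P by rewrite -ghP; ring.
  by rewrite /F /F' omC -pevM vu pevM P0 pev_at0.
pose f := hcomp (pevh e (u * g)) om'.
have fE x : f x = F' x by [].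
have xf x : x - f x = F x by rewrite fE -{1}[x]FF' addrK.
(* [Phi] is the identity on the image of [f] and [id - e] on the complement. It is onto by Nakayama:
   a truncated geometric series inverts [id - e] up to the [a]-th power of [e], which on the
   complement acts as ['X^a - g], with coefficients in [m]. *)
pose Phi : lhom X X := f + hcomp (hid X - e) (hid X - f).
have PhiE x : Phi x = f x + (x - f x - e (x - f x)) by [].
have ff x : f (f x) = f x.
  by apply/eqP; rewrite eq_sym -subr_eq0 xf FF0.
have f0 x : f (x - f x) = 0 by rewrite [LHS](linearB f) ff subrr.
have fP p x : f (pev e p x) = pev e p (f x).
  by rewrite !fE /F' omC -!pevM mulrC.
have [d [PhiK _]] : exists d : lhom X X, cancel Phi d /\ cancel d Phi.
  have Phis : surjective_map Phi.
    apply: (nakayama_surj idm m1 mU) fX _ => x.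
    pose z := x - f x; pose S : {poly R} := \sum_(i < a) 'X^i.
    exists (f x + pev e S z), (pev e ('X^a - g) z); split.
      by apply: pev_in_mX => i; rewrite coefB -opprB; apply: idealN.
    have fz : f z = 0 := f0 x.
    have -> : pev e ('X^a - g) z = pev e 'X^a z.
      by rewrite pevD pevN /z xf gF subr0.
    have fy : f (f x + pev e S z) = f x.
      by rewrite [LHS](linearD f) ff fP fz pev_at0 addr0.
    rewrite PhiE fy [f x + pev _ _ _]addrC addrK.
    rewrite -pev_Xmul -pevN -pevD -addrA -pevD.
    rewrite -{1}[S]mul1r -mulrBl geometric_sum subrK pev1.
    by rewrite /z addrC subrK.
  by apply: bij_inverse => //; exact: (surj_endo_inj noethR).
exists f, (pevh e k), d; split=> // x.
- have : pev e (s *: h) (F' x) = 0 by rewrite pevZ hF' scaler0.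
  by rewrite hk pevD pev1 pevN pev_mulX => /eqP; rewrite subr_eq0 => /eqP.
- by rewrite -[in RHS](PhiK (x - f x)) PhiE f0 add0r subr0.
Qed.

End Fitting.

(** * Finitely presented functors on the stable category *)

Lemma comp_zerom (A : preadditive) (X Y Z : A) (g : hom Y Z) :
  comp g (zerom X Y) = zerom X Z.
Proof.
have h : addm (comp g (zerom X Y)) (comp g (zerom X Y)) = comp g (zerom X Y).
  by rewrite -compDr add0m.
by rewrite -[LHS]add0m -{1}(addNm (comp g (zerom X Y))) -addmA h addNm.
Qed.

Section NatTrans.
Variable A : preadditive.
Implicit Types F G H : cofunctor A.

(** Arbitrary pointwise sections of [b] suffice: the values of [p] do not depend on their choice,
    which restores additivity and naturality. *)
Lemma nattrans_factor F G H (b : nattrans F G) (p : nattrans F H) :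
  (forall W, surjective_map (b W)) -> (forall W x, b W x = 0 -> p W x = 0) ->
  exists q : nattrans G H, forall W x, q W (b W x) = p W x.
Proof.
move=> bs bp.
have [s sE] : exists s : forall W, G W -> F W, forall W y, b W (s W y) = y.
  exists (fun W => projT1 (choice (bs W))) => W y.
  exact: (projT2 (choice (bs W))).
have pE W x y : b W x = b W y -> p W x = p W y.
  by move=> e; apply/eqP; rewrite -subr_eq0 -raddfB bp // raddfB e subrr.
have add W : zmod_morphism (fun y => p W (s W y)).
  by move=> x y; rewrite -raddfB; apply: pE; rewrite raddfB !sE.
pose q W : {additive G W -> H W} := HB.pack_for {additive G W -> H W}
  (fun y => p W (s W y)) (GRing.isZmodMorphism.Build _ _ _ (add W)).
have qN (X Y : A) (f : hom X Y) (x : G Y) : q X (fmap G f x) = fmap H f (q Y x).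
  by rewrite /= -ntcN; apply: pE; rewrite sE ntcN sE.
by exists (Nattrans qN) => W x /=; apply: pE; rewrite sE.
Qed.

End NatTrans.

Section StableFunctors.
Variables (R : comNzRingType) (C : lmodType R -> Prop).
Notation SC := (stable_category C).
Implicit Types (X Y Z W : SC) (G : cofunctor SC).

Section Yoneda.
Variables (G : cofunctor SC) (X : SC) (x : G X).

Fact yoneda_additive W :
  zmod_morphism (fun z : stable_hom (sval W) (sval X) => @fmap _ G W X z x).
Proof.
move=> y z; apply: (addIr (@fmap _ G W X z x)); rewrite subrK.
by rewrite -[LHS](fmapD (c := G) (y - z : hom W X) (z : hom W X)) /= subrK.
Qed.

Definition yoneda_at W : {additive representable X W -> G W} :=
  HB.pack_for {additive representable X W -> G W}
    (fun z : stable_hom (sval W) (sval X) => @fmap _ G W X z x)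
    (GRing.isZmodMorphism.Build _ _ _ (@yoneda_additive W)).

Fact yoneda_natural W V (f : hom W V) (z : representable X V) :
  yoneda_at W (fmap (representable X) f z) = fmap G f (yoneda_at V z).
Proof. exact: (fmapM (c := G) (z : hom V X) f x). Qed.

Definition yoneda : nattrans (representable X) G := Nattrans yoneda_natural.

Lemma yonedaE W (z : hom W X) : yoneda W z = fmap G z x. Proof. by []. Qed.

End Yoneda.

Lemma yoneda_lemma G X (b : nattrans (representable X) G) W (z : hom W X) :
  b W z = fmap G z (b X (idm X)).
Proof.
rewrite -(ntcN b); congr (b W _); exact/esym/(comp1m (p := SC)).
Qed.

Section CokernelFunctor.
Variables (Z X : SC) (h : hom Z X).

Definition postcomp_image W : {pred stable_hom (sval W) (sval X)} :=
  fun x => `[< exists z : hom W Z, comp h z = x >].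

Fact postcomp_image_closed W : zmod_closed (@postcomp_image W).
Proof.
have sub : forall z z' : hom W Z,
    comp h (z - z' : hom W Z) = (comp h z : stable_hom _ _) - comp h z'.
  move=> z z'; apply: (addIr (comp h z' : stable_hom _ _)).
  rewrite -[LHS](compDr (p := SC) h (z - z' : hom W Z) z').
  by rewrite subrK /=; congr (stable_comp h _); exact: subrK.
split=> [|_ _ /asboolP[z <-] /asboolP[z' <-]]; apply/asboolP.
  by exists 0; rewrite -{1}(subrr (0 : stable_hom _ _)) sub subrr.
by exists (z - z').
Qed.

HB.instance Definition _ W := GRing.isZmodClosed.Build
  (stable_hom (sval W) (sval X)) (@postcomp_image W) (@postcomp_image_closed W).

Definition cokf_ob W : zmodType := Quotient.quot (@postcomp_image W).

Definition cokf_class W (x : hom W X) : cokf_ob W :=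
  (\pi_(Quotient.quot (@postcomp_image W)) x)%qT.

Lemma cokf_classP W (x y : stable_hom (sval W) (sval X)) :
  cokf_class x = cokf_class y <-> exists z : hom W Z, comp h z = x - y.
Proof.
rewrite -(asboolE (exists _, _)).
rewrite -[X in _ <-> is_true X]/((x - y) \in @postcomp_image W).
by rewrite Quotient.idealrBE; split=> /eqP.
Qed.

Lemma cokf_classD W (x y : stable_hom (sval W) (sval X)) :
  cokf_class (x + y) = cokf_class x + cokf_class y.
Proof. by rewrite /cokf_class !piE. Qed.

Lemma cokf_surj W (x : cokf_ob W) : exists y, cokf_class y = x.
Proof. exists (repr (x : Quotient.quot _)); exact: reprK. Qed.

Definition cokf_fun V W (f : hom V W) (x : cokf_ob W) : cokf_ob V :=
  cokf_class (comp (repr (x : Quotient.quot (@postcomp_image W)) : hom W X) f).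

Lemma cokf_funE V W (f : hom V W) x :
  cokf_fun f (cokf_class x) = cokf_class (comp x f).
Proof.
set x' := repr (cokf_class x : Quotient.quot _).
have /cokf_classP[z zE] : cokf_class x' = cokf_class x by exact: reprK.
apply/cokf_classP; exists (comp z f); rewrite compA zE.
exact: (@stable_precomp_additive R C V W X f x' x).
Qed.

Fact cokf_fun_additive V W (f : hom V W) : zmod_morphism (cokf_fun f).
Proof.
move=> x y; apply: (addIr (cokf_fun f y)); rewrite subrK.
have [x' <-] := cokf_surj x; have [y' <-] := cokf_surj y.
have -> : cokf_class x' - cokf_class y' = cokf_class (x' - y' : stable_hom _ _).
  by apply: (addIr (cokf_class y')); rewrite -cokf_classD !subrK.
rewrite !cokf_funE -cokf_classD; congr cokf_class.
rewrite -[LHS](compDl (p := SC) (x' - y' : stable_hom _ _) y' f).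
by rewrite /=; congr (stable_comp _ f); exact: subrK.
Qed.

Definition cokf_map V W (f : hom V W) : {additive cokf_ob W -> cokf_ob V} :=
  HB.pack_for {additive cokf_ob W -> cokf_ob V} (cokf_fun f)
    (GRing.isZmodMorphism.Build _ _ _ (cokf_fun_additive f)).

#[local] Obligation Tactic := idtac.

Program Definition cokernel_functor : cofunctor SC :=
  {| fob := cokf_ob; fmap := cokf_map |}.
Next Obligation.
by move=> W x; have [y <-] := cokf_surj x; rewrite /= cokf_funE compm1.
Qed.
Next Obligation.
by move=> U V W g f x; have [y <-] := cokf_surj x; rewrite /= !cokf_funE compA.
Qed.
Next Obligation.
move=> V W f g x; have [y <-] := cokf_surj x; rewrite /= !cokf_funE.
by rewrite -cokf_classD compDr.
Qed.

Definition cokf_proj : nattrans (representable X) cokernel_functor :=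
  yoneda (G := cokernel_functor) (X := X) (cokf_class (idm X)).

Lemma cokf_projE W (x : hom W X) : cokf_proj W x = cokf_class x.
Proof. by rewrite yonedaE /= cokf_funE comp1m. Qed.

Lemma cokf_proj_surj W : surjective_map (cokf_proj W).
Proof. by move=> y; have [x <-] := cokf_surj y; exists x; exact: cokf_projE. Qed.

Lemma cokf_proj0 W (x : hom W X) :
  cokf_proj W x = 0 <-> exists z : hom W Z, comp h z = x.
Proof.
have c0 : cokf_class (0 : stable_hom (sval W) (sval X)) = 0.
  by apply: (addIr (cokf_class (0 : stable_hom (sval W) (sval X))));
    rewrite -cokf_classD !add0r.
rewrite cokf_projE -c0 cokf_classP.
by split=> -[z zE]; exists z; rewrite zE ?subr0.
Qed.

Lemma cokernel_functor_fp : finitely_presented cokernel_functor.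
Proof.
exists Z, X, (yoneda (G := representable X) (X := Z) h), cokf_proj => W.
split; first exact: cokf_proj_surj.
exact: cokf_proj0.
Qed.

End CokernelFunctor.

Lemma representable_fp X : finitely_presented (representable X).
Proof.
exists X, X, (nt_zero _ _), (nt_id _) => W; split=> [y|y]; first by exists y.
by split=> [/= ->|[z <-]//]; exists 0.
Qed.

End StableFunctors.

Section Frobenius.
Variables (R : comNzRingType) (C : lmodType R -> Prop).
Hypotheses (subC : subcategory C) (frobC : frobenius (mod_stable C)).
Notation SC := (stable_category C).
Notation MS := (mod_stable C).
Implicit Types (X Y Z W : SC) (F G H : MS).

Definition rep X : MS := exist _ (representable X) (representable_fp X).

Definition stob (A : lmodType R) (CA : C A) : SC := exist _ A CA.

(** Direct sums merge two families of relations on a representable functor into one, so imposing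
    more relations keeps a functor finitely presented. *)
Lemma stable_sum A B X (h1 : hom A X) (h2 : hom B X) :
  exists Z (h : hom Z X), forall W (x : hom W X),
    (exists z : hom W Z, comp h z = x) <->
    exists (z1 : hom W A) (z2 : hom W B), x = addm (comp h1 z1) (comp h2 z2).
Proof.
case: A h1 => A CA h1; case: B h2 => B CB h2.
have CAB : C (A * B)%type.
  by apply/(subcat_sum subC); [exact: (subcat_fingen subC)..|split].
pose h : lhom (A * B)%type (sval X) := copairh (stable_repr h1) (stable_repr h2).
exists (stob CAB), (stable_class h) => W x; split.
  case=> z <-; rewrite -(stable_reprK z); set z' := stable_repr z.
  exists (stable_class (hcomp (fsth A B) z')), (stable_class (hcomp (sndh A B) z')).
  rewrite -(stable_reprK h1) -(stable_reprK h2) /= !stable_compE.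
  by rewrite -stable_classD; congr stable_class; apply: lhom_ext.
case=> z1 [z2 ->]; exists (stable_class (pairh (stable_repr z1) (stable_repr z2))).
rewrite -[in RHS](stable_reprK z1) -[in RHS](stable_reprK z2).
rewrite -[in RHS](stable_reprK h1) -[in RHS](stable_reprK h2) /= !stable_compE.
by rewrite -stable_classD; congr stable_class; apply: lhom_ext.
Qed.

(** The pointwise cokernel of [e] is finitely presented: to the relations [h1] of [G] add [h2], a
    lift of the generator of [F]. It is therefore a legitimate test object, and the map from [G] to
    it vanishes because [e] is epi. *)
Lemma epi_surjective F G (e : hom F G) : epi e -> forall X, surjective_map (e X).
Proof.
move=> epe X y.
have [Y1 [Y0 [d [c cF]]]] := svalP F; have [X1 [X0 [a [b bG]]]] := svalP G.
pose h1 : hom X1 X0 := a X1 (idm X1).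
have [h2 h2E] : exists h2 : hom Y0 X0, b Y0 h2 = e Y0 (c Y0 (idm Y0)).
  exact: (bG Y0).1.
have [Z [h hE]] := stable_sum h1 h2.
have eb W (z : hom W Y0) : e W (c W z) = b W (comp h2 z).
  rewrite (yoneda_lemma c) ntcN -h2E -(ntcN b); reflexivity.
have ab W (z : hom W X1) : b W (comp h1 z) = 0.
  apply/(bG W).2; exists z; exact: yoneda_lemma.
pose H : MS := exist _ (cokernel_functor h) (cokernel_functor_fp h).
have [W x bx|q qE] := nattrans_factor (b := b) (p := cokf_proj h) (fun W => (bG W).1).
  apply/cokf_proj0/hE; have [z zE] := ((bG W).2 x).1 bx; exists z, 0.
  rewrite -zE (yoneda_lemma a) [comp h2 _]comp_zerom; exact/esym/addr0.
have q0 : (q : hom G H) = zerom G H.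
  apply: epe; apply: nattrans_ext => W x /=.
  have [z <-] := (cF W).1 x; rewrite eb qE; apply/cokf_proj0/hE.
  exists 0, z; rewrite [comp h1 _]comp_zerom; exact/esym/add0r.
have [x xE] := (bG X).1 y.
have : cokf_proj h X x = 0 by rewrite -qE q0.
move=> /cokf_proj0/hE[z1 [z2 xE']]; exists (c X z2).
by rewrite eb -xE xE' [RHS]raddfD ab add0r.
Qed.

Lemma injective_mono F G (e : hom F G) :
  (forall X x, e X x = 0 -> x = 0) -> mono e.
Proof.
move=> inj W g h gh; apply: nattrans_ext => X x; apply/eqP; rewrite -subr_eq0.
apply/eqP/inj; rewrite raddfB; apply/eqP; rewrite subr_eq0; apply/eqP.
exact: (congr1 (fun t : nattrans _ _ => t X x) gh).
Qed.

Lemma mono_injective F G (e : hom F G) :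
  mono e -> forall X x, e X x = 0 -> x = 0.
Proof.
move=> me X x ex.
have : (yoneda x : hom (rep X) F) = zerom (rep X) F.
  apply: me; apply: nattrans_ext => W z /=.
  by rewrite ntcN ex !raddf0.
move/(congr1 (fun t : nattrans (representable X) (sval F) =>
  t X (idm X : representable X X))).
by rewrite yonedaE fmap1.
Qed.

Lemma rep_projective X : projective_object (rep X).
Proof.
move=> F G e f epe; have [x xE] := epi_surjective epe ((f : nattrans _ _) X (idm X)).
exists (yoneda x); apply: nattrans_ext => W z /=.
by rewrite ntcN xE -(yoneda_lemma f).
Qed.

Lemma rep_injective X : injective_object (rep X).
Proof. by apply: (frobenius_projective_injective frobC); exact: rep_projective. Qed.

(** The weak kernel [kap] presents the image of Hom(-, U) in Hom(-, X). This image maps to Hom(-, V)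
    through [psi], and injectivity of Hom(-, V) extends that map to Hom(-, X), where Yoneda turns it
    into [al]. *)
Lemma stable_extension U X V K (phi : hom U X) (psi : hom U V) (kap : hom K U) :
  (forall A (a : hom A U), comp phi a = zerom _ _ <-> exists z, comp kap z = a) ->
  (forall A (a : hom A U), comp phi a = zerom _ _ -> comp psi a = zerom _ _) ->
  exists al : hom X V, comp al phi = psi.
Proof.
move=> wk pp; pose F : MS := exist _ (cokernel_functor kap) (cokernel_functor_fp kap).
have fac Y (f : hom U Y) : (forall A (a : hom A U), comp phi a = zerom _ _ -> comp f a = zerom _ _) ->
    exists q : nattrans (cokernel_functor kap) (representable Y),
      forall W (x : hom W U), q W (cokf_proj kap W x) = comp f x.
  move=> hf; have [|W x /cokf_proj0/wk/hf|q qE] := nattrans_factor (b := cokf_proj kap)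
      (p := yoneda (G := representable Y) (X := U) f); last by exists q.
    exact: cokf_proj_surj.
  by [].
have [m mE] := fac X phi (fun _ _ => id); have [f fE] := fac V psi pp.
have mm : mono (m : hom F (rep X)).
  apply: injective_mono => W y; have [x <-] := @cokf_proj_surj _ _ _ _ kap W y.
  by rewrite mE => /wk/cokf_proj0.
have [h hE] := rep_injective (f : hom F (rep V)) mm.
pose t : nattrans (representable X) (representable V) := h.
exists (t X (idm X)).
have : t U (m U (cokf_proj kap U (idm U))) = f U (cokf_proj kap U (idm U)).
  exact: (congr1 (fun t : nattrans (cokernel_functor kap) (representable V) =>
    t U (cokf_proj kap U (idm U))) hE).
rewrite mE fE (compm1 (p := SC) phi) (compm1 (p := SC) psi) => <-.
exact: (esym (yoneda_lemma t phi)).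
Qed.

(** The cokernel of Hom(-, h) embeds into an injective object, which is projective and so a retract
    of a representable functor. The composite from Hom(-, X0) comes from some [k], of which [h] is
    then a weak kernel. *)
Lemma stable_weak_cokernel X1 X0 (h : hom X1 X0) :
  exists Y (k : hom X0 Y), forall A (a : hom A X0),
    comp k a = zerom _ _ <-> exists b, comp h b = a.
Proof.
pose F : MS := exist _ (cokernel_functor h) (cokernel_functor_fp h).
have [I [m [injI monoM]]] := frobenius_enough_injectives frobC F.
have projI := frobenius_injective_projective frobC injI.
have [X1' [X0' [a [b bI]]]] := svalP I.
have epb : epi (b : hom (rep X0') I).
  move=> W g g' gg; apply: nattrans_ext => Y y; have [x <-] := (bI Y).1 y.
  exact: (congr1 (fun t : nattrans (representable X0') (sval W) => t Y x) gg).
have [s sE] := projI _ _ _ (idm I) epb.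
have sb W (y : sval I W) : (s : nattrans _ _) W y = 0 -> y = 0.
  move=> sy; rewrite -[y](_ : (comp (b : hom (rep X0') I) s : nattrans _ _) W y = y).
    by rewrite /= sy raddf0.
  by rewrite sE.
pose t : nattrans (representable X0) (representable X0') :=
  nt_comp (nt_comp s m) (cokf_proj h).
exists X0', (t X0 (idm X0)) => W x.
rewrite -[comp _ x](yoneda_lemma t x) -cokf_proj0 /=.
split=> [/sb|->]; last by rewrite !raddf0.
exact: (mono_injective monoM).
Qed.

End Frobenius.

(** * Stably zero maps *)

Section StablyZero.
Variable R : comNzRingType.
Implicit Types X Y Z W P Q K A B : lmodType R.

Definition stably_zero X Y (f : lhom X Y) : Prop := factors_through_projective f.

Lemma stably_zeroE X Y (f : lhom X Y) : stably_zero f <-> f \in @proj_homs R X Y.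
Proof. by split=> /asboolP. Qed.

Lemma stably_zeroD X Y (f g : lhom X Y) : stably_zero f -> stably_zero g -> stably_zero (f + g).
Proof. by rewrite !stably_zeroE; exact: rpredD. Qed.
Lemma stably_zeroN X Y (f : lhom X Y) : stably_zero f -> stably_zero (- f).
Proof. by rewrite !stably_zeroE rpredN. Qed.
Lemma stably_zeroB X Y (f g : lhom X Y) : stably_zero f -> stably_zero g -> stably_zero (f - g).
Proof. by rewrite !stably_zeroE; exact: rpredB. Qed.

Lemma stably_zero_compl X Y Z (g : lhom Y Z) (f : lhom X Y) : stably_zero f -> stably_zero (hcomp g f).
Proof.
move=> [P [a [b [pP fE]]]]; exists P, a, (hcomp g b); split=> // x /=.
by rewrite fE.
Qed.

Lemma stably_zero_compr X Y Z (g : lhom Y Z) (f : lhom X Y) : stably_zero g -> stably_zero (hcomp g f).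
Proof.
move=> [P [a [b [pP gE]]]]; exists P, (hcomp a f), b; split=> // x /=.
by rewrite gE.
Qed.

Lemma stably_zero0 X Y (f : lhom X Y) : (forall x, f x = 0) -> stably_zero f.
Proof. by move=> f0; rewrite [f](lhom_ext (g := 0)) // stably_zeroE rpred0. Qed.

Lemma stably_zero_projl P X (f : lhom P X) : projective P -> stably_zero f.
Proof. by move=> pP; exists P, (hid P), f. Qed.

Lemma stably_zero_projr P X (f : lhom X P) : projective P -> stably_zero f.
Proof. by move=> pP; exists P, f, (hid P). Qed.

(** The projective module in the factorization may be infinitely generated; its map to [Y] lifts to
    a finite free cover of [Y]. *)
Lemma stably_zero_free X Y (f : lhom X Y) : fingen Y -> stably_zero f ->
  exists n (a : lhom X 'rV[R]_n) (b : lhom 'rV[R]_n Y), forall x, f x = b (a x).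
Proof.
move=> fY [P [a [b [pP fE]]]]; have [n [p ps]] := free_cover fY.
have [k kE] := pP _ _ p b ps; exists n, (hcomp k a), p => x.
by rewrite fE /= kE.
Qed.

Lemma hcompBr X Y Z (g : lhom Y Z) (f h : lhom X Y) :
  hcomp g (f - h) = hcomp g f - hcomp g h.
Proof. by apply: lhom_ext => x; exact: linearB. Qed.

Lemma hcompA X Y Z W (h : lhom Z W) (g : lhom Y Z) (f : lhom X Y) :
  hcomp h (hcomp g f) = hcomp (hcomp h g) f.
Proof. exact: lhom_ext. Qed.

Lemma stable_class0P X Y (f : lhom X Y) : stable_class f = 0 <-> stably_zero f.
Proof.
have -> : 0 = stable_class (0 : lhom X Y).
  by apply: (addIr (stable_class (0 : lhom X Y))); rewrite -stable_classD !add0r.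
by rewrite stable_classP subr0.
Qed.

Lemma inj_surj_iso X Y (f : lhom X Y) : injective f -> surjective_map f ->
  isomorphic X Y.
Proof.
move=> fi fs; have [g [gK fK]] := bij_inverse fi fs.
by exists f; exists g.
Qed.

Lemma split_bijective X Y Z (i : lhom X Y) (g : lhom Y Z) (r : lhom Y X) :
  short_exact i g -> (forall x, r (i x) = x) ->
  injective (pairh r g) /\ surjective_map (pairh r g).
Proof.
move=> [ii ig gs] ri; split.
  apply: inj0 => y [ry /ig[x xy]]; move: ry; rewrite -xy ri => ->.
  exact: linear0.
move=> [x z]; have [y <-] := gs z; exists (i x + (y - i (r y))) => /=.
have gi x' : g (i x') = 0 by apply/ig; exists x'.
by rewrite !linearD !linearN /= !ri !gi subrr addr0 add0r oppr0 addr0.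
Qed.

(* A map vanishing stably after composition with [i] does so because the next
   term [K] of the stable long exact sequence is projective. *)
Lemma stable_mono Z V W K P A (i : lhom Z V) (g : lhom V W) (j : lhom K P)
    (q : lhom P W) (a : lhom A Z) :
  short_exact i g -> short_exact j q -> projective P -> projective K ->
  stably_zero (hcomp i a) -> stably_zero a.
Proof.
move=> [ii ig gs] [ji jq qs] pP pK [Q [rho [gam [pQ iaE]]]].
have [s sE] := pP _ _ g q gs.
have [l lE] := pQ _ _ q (hcomp g gam) qs.
have [|mu muE] := @lift_mono _ Q Z V i (gam - hcomp s l) ii.
  by move=> y; apply/ig; rewrite /= linearB sE lE subrr.
have [|kap kapE] := @lift_mono _ A K P j (hcomp l rho) ji.
  move=> x; apply/jq; rewrite /= lE /= -iaE /=; apply/ig.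
  by exists (a x).
have [|sK sKE] := @lift_mono _ K Z V i (hcomp s j) ii.
  by move=> x; apply/ig; rewrite /= sE; apply/jq; exists x.
have -> : a = hcomp sK kap + hcomp mu rho.
  apply: lhom_ext => x; apply: ii; rewrite [RHS]linearD [X in X + _]sKE /=.
  by rewrite kapE [X in _ + X]muE /= addrC subrK; exact: iaE.
by apply: stably_zeroD; [apply: stably_zero_compl; exact: stably_zero_projr | apply: stably_zero_compr; exact: stably_zero_projl].
Qed.

(** Lifting the factorization of [hcomp g a] through [g] corrects [a] to a map into the kernel [P],
    which is projective as well. *)
Lemma stable_mono_proj P Y X A (i : lhom P Y) (g : lhom Y X) (a : lhom A Y) :
  projective P -> short_exact i g -> stably_zero (hcomp g a) -> stably_zero a.
Proof.
move=> pP [ii ig gs] [Q [rho [gam [pQ gaE]]]].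
have [l lE] := pQ _ _ g gam gs.
have [|k kE] := @lift_mono _ A P Y i (a - hcomp l rho) ii.
  move=> x; apply/ig; rewrite /= linearB lE -gaE; exact: subrr.
have -> : a = hcomp i k + hcomp l rho.
  by apply: lhom_ext => x /=; rewrite kE /= subrK.
by apply: stably_zeroD; [apply: stably_zero_compl; exact: stably_zero_projr | apply: stably_zero_compr; exact: stably_zero_projl].
Qed.

(** A lift through [p'] of the factorization of [f] corrects [F] to a map into [K']; the correction
    passes through [p] and so vanishes on [K]. The conclusion is more than stable vanishing: [f0]
    extends to [P]. *)
Lemma syzygy_factor K P X K' P' X' (i : lhom K P) (p : lhom P X)
    (i' : lhom K' P') (p' : lhom P' X') (F : lhom P P') (f : lhom X X')
    (f0 : lhom K K') :
  short_exact i p -> short_exact i' p' ->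
  (forall x, p' (F x) = f (p x)) -> (forall k, i' (f0 k) = F (i k)) ->
  stably_zero f -> exists w : lhom P K', f0 = hcomp w i.
Proof.
move=> [ii ip ps] [ii' ip' ps'] Ff f0E [Q [rho [gam [pQ fE]]]].
have [l lE] := pQ _ _ p' gam ps'.
have [|w wE] := @lift_mono _ P K' P' i' (F - hcomp l (hcomp rho p)) ii'.
  by move=> x; apply/ip'; rewrite /= linearB lE Ff -fE subrr.
exists w; apply: lhom_ext => k; apply: ii'; rewrite f0E /= wE /=.
have -> : p (i k) = 0 by apply/ip; exists k.
by rewrite (linear0 rho) (linear0 l) subr0.
Qed.

Lemma syzygy_stably_zero K P X K' P' X' (i : lhom K P) (p : lhom P X)
    (i' : lhom K' P') (p' : lhom P' X') (F : lhom P P') (f : lhom X X')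
    (f0 : lhom K K') :
  short_exact i p -> short_exact i' p' -> projective P ->
  (forall x, p' (F x) = f (p x)) -> (forall k, i' (f0 k) = F (i k)) ->
  stably_zero f -> stably_zero f0.
Proof.
move=> ex ex' pP Ff f0E szf; have [w ->] := syzygy_factor ex ex' Ff f0E szf.
by apply: stably_zero_compr; exact: stably_zero_projl.
Qed.

End StablyZero.

(** * Weak kernels and weak cokernels for a resolving subcategory *)

Section Resolving.
Variables (R : comNzRingType) (C : lmodType R -> Prop).
Hypothesis noethR : noetherian R.
Hypotheses (subC : subcategory C) (resC : resolving C).
Implicit Types X Y Z W P Q K A B : lmodType R.

Let Cfg X : C X -> fingen X := subcat_fingen subC (X := X).

Lemma C_free n : C 'rV[R]_n.
Proof. by apply: (subcat_proj subC); [exact: free_fingen | exact: free_projective]. Qed.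

Lemma C_prod X Y : C X -> C Y -> C (X * Y)%type.
Proof. by move=> CX CY; apply/(subcat_sum subC); [exact: Cfg..|split]. Qed.

Lemma C_kernel K Y Z (i : lhom K Y) (g : lhom Y Z) :
  short_exact i g -> C Y -> C Z -> C K.
Proof.
move=> ex CY CZ; have [ii _ _] := ex.
by have [_] := resC (fingen_sub noethR ii (Cfg CY)) (Cfg CY) (Cfg CZ) ex; apply.
Qed.

Lemma C_extension K Y Z (i : lhom K Y) (g : lhom Y Z) :
  short_exact i g -> C K -> C Z -> C Y.
Proof.
move=> ex CK CZ; have [_ ig gs] := ex; have fY := fingen_ext ig gs (Cfg CK) (Cfg CZ).
by have [+ _] := resC (Cfg CK) fY (Cfg CZ) ex; apply.
Qed.

Lemma C_split X Y Z (i : lhom X Y) (g : lhom Y Z) (r : lhom Y X) :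
  short_exact i g -> (forall x, r (i x) = x) -> C Y -> C X /\ C Z.
Proof.
move=> ex ri CY; have fY := Cfg CY; have [_ _ gs] := ex.
have rs : surjective_map r by move=> x; exists (i x).
have [rgi rgs] := split_bijective ex ri.
apply/(subcat_sum subC); [exact: fingen_surj rs fY | exact: fingen_surj gs fY|].
exact: (subcat_iso subC) (inj_surj_iso rgi rgs) CY.
Qed.

Lemma C_ffun X n : C X -> C {ffun 'I_n -> X}.
Proof.
move=> CX; elim: n => [|n IH].
  apply: (subcat_proj subC).
    exists 0%N, (fun=> 0) => x; exists (fun=> 0); rewrite big_ord0.
    by apply/ffunP => -[].
  move=> Y Z g h gs; exists (lhom0 _ _) => x; rewrite linear0.
  by have -> : x = 0; [apply/ffunP => -[] | rewrite linear0].
pose f (v : {ffun 'I_n.+1 -> X}) : X * {ffun 'I_n -> X} :=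
  (v ord0, [ffun i => v (lift ord0 i)]).
have lf : linear f.
  move=> a u v; congr (_, _); first by rewrite !ffunE.
  by apply/ffunP => i; rewrite !ffunE.
pose g (v : X * {ffun 'I_n -> X}) : {ffun 'I_n.+1 -> X} :=
  [ffun i => oapp v.2 v.1 (unlift ord0 i)].
have lg : linear g.
  move=> a u v; apply/ffunP => i; rewrite !ffunE.
  by case: (unliftP ord0 i) => [j _|_] /=; rewrite ?ffunE.
apply: (subcat_iso subC) (C_prod CX IH); exists (mkhom lg); exists (mkhom lf) => /=.
  move=> [x v]; congr (_, _); first by rewrite ffunE unlift_none.
  by apply/ffunP => i; rewrite !ffunE liftK.
move=> v; apply/ffunP => i; rewrite !ffunE.
by case: (unliftP ord0 i) => [j ->|->] //=; rewrite ffunE.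
Qed.

Lemma projective_ffun P n : projective P -> projective ({ffun 'I_n -> P} : lmodType R).
Proof.
move=> pP Y Z g h gs.
pose e (j : 'I_n) (x : P) : {ffun 'I_n -> P} := [ffun i => if i == j then x else 0].
have le j : linear (e j).
  move=> a x y; apply/ffunP => i; rewrite !ffunE.
  by case: eqP => _; rewrite ?scaler0 ?addr0.
have [k kE] := choice (fun j => pP _ _ g (hcomp h (mkhom (le j))) gs).
have lk : linear (fun v : {ffun 'I_n -> P} => \sum_j k j (v j)).
  move=> a u v; rewrite scaler_sumr -big_split; apply: eq_bigr => j _ /=.
  by rewrite !ffunE linearP.
exists (mkhom lk) => v /=; rewrite linear_sum.
under eq_bigr do rewrite kE /=; rewrite -linear_sum; congr (h _).
apply/ffunP => i; rewrite sum_ffunE (bigD1 i) //= ffunE eqxx big1 ?addr0 //.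
by move=> j /negbTE ji; rewrite ffunE eq_sym ji.
Qed.

Lemma weak_kernelP U X P K (phi : lhom U X) (p : lhom P X) (i : lhom K (P * U)%type) :
  projective P -> surjective_map p -> short_exact i (copairh p phi) ->
  forall A (a : lhom A U), stably_zero (hcomp phi a) <->
    exists z : lhom A K, stably_zero (hcomp (hcomp (sndh P U) i) z - a).
Proof.
move=> pP ps [ii ik _] A a.
have pE k : p (i k).1 + phi (i k).2 = 0 by apply/(ik (i k)); exists k.
split=> [[Q [rho [gam [pQ paE]]]]|[z zE]].
  have [l lE] := pQ _ _ p gam ps.
  have [|z zE] := @lift_mono _ A K _ i (pairh (- hcomp l rho) a) ii.
    move=> x; apply/ik; rewrite /= linearN lE -paE /=; exact: addNr.
  by exists z; apply: stably_zero0 => x; rewrite /= zE /= subrr.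
have -> : hcomp phi a =
    hcomp (- p) (hcomp (hcomp (fsth _ _) i) z) - hcomp phi (hcomp (hcomp (sndh _ _) i) z - a).
  apply: lhom_ext => x /=.
  by rewrite (linearB phi) opprB addrCA -opprD pE oppr0 addr0.
by apply: stably_zeroB; [apply: stably_zero_compr; exact: stably_zero_projl | exact: stably_zero_compl].
Qed.

Lemma copairh_kernel U X P (phi : lhom U X) (p : lhom P X) : surjective_map p ->
  exists K (i : lhom K (P * U)%type), short_exact i (copairh p phi).
Proof.
move=> ps; have [K [i [ii ik]]] := kernel_exists (copairh p phi).
exists K, i; split=> // x; have [v <-] := ps x; exists (v, 0) => /=.
by rewrite linear0 addr0.
Qed.

Lemma weak_kernel U X (phi : lhom U X) : C U -> C X ->
  exists K (kap : lhom K U), C K /\ forall A (a : lhom A U),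
    stably_zero (hcomp phi a) <-> exists z : lhom A K, stably_zero (hcomp kap z - a).
Proof.
move=> CU CX; have [n [p ps]] := free_cover (Cfg CX).
have [K [i ex]] := copairh_kernel phi ps.
exists K, (hcomp (sndh _ _) i); split; last first.
  by apply: weak_kernelP ex => //; exact: free_projective.
by apply: (C_kernel ex) CX; apply: C_prod => //; exact: C_free.
Qed.

Hypothesis frobC : frobenius (mod_stable C).

Lemma extension_of_stable_maps U X V (phi : lhom U X) (psi : lhom U V) :
  C U -> C X -> C V ->
  (forall A (a : lhom A U), C A -> stably_zero (hcomp phi a) -> stably_zero (hcomp psi a)) ->
  exists al : lhom X V, stably_zero (hcomp al phi - psi).
Proof.
move=> CU CX CV h; have [K [kap [CK kE]]] := weak_kernel phi CU CX.
have [||al alE] := stable_extension subC frobC (U := stob CU) (X := stob CX)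
  (V := stob CV) (K := stob CK) (phi := stable_class phi) (psi := stable_class psi)
  (kap := stable_class kap).
- move=> A a; rewrite -(stable_reprK a) /= stable_compE stable_class0P kE.
  split=> [[z /stable_classP zE]|[z zE]].
    by exists (stable_class z); rewrite /= stable_compE.
  exists (stable_repr z); apply/stable_classP.
  by rewrite -zE -{2}(stable_reprK z) /= stable_compE.
- move=> A a; rewrite -(stable_reprK a) /= !stable_compE !stable_class0P.
  by apply: h; exact: svalP.
exists (stable_repr al); apply/stable_classP.
by rewrite -alE /= -stable_compE stable_reprK.
Qed.

Lemma stable_retraction Y X (g : lhom Y X) : C Y -> C X ->
  (forall A (a : lhom A Y), C A -> stably_zero (hcomp g a) -> stably_zero a) ->
  exists s : lhom X Y, stably_zero (hcomp s g - hid Y).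
Proof. by move=> CY CX h; apply: extension_of_stable_maps => // A a CA /(h A a CA). Qed.

Lemma weak_cokernel X1 X0 (h : lhom X1 X0) : C X1 -> C X0 ->
  exists Y (k : lhom X0 Y), C Y /\ forall A (a : lhom A X0), C A ->
    (stably_zero (hcomp k a) <-> exists b : lhom A X1, stably_zero (hcomp h b - a)).
Proof.
move=> C1 C0.
have [[Y CY] [k kE]] := @stable_weak_cokernel _ _ frobC (stob C1) (stob C0)
  (stable_class h).
exists Y, (stable_repr k); split=> // A a CA.
have := kE (stob CA) (stable_class a).
rewrite -{1}(stable_reprK k) /= stable_compE stable_class0P => ->.
split=> [[b bE]|[b bE]].
  by exists (stable_repr b); apply/stable_classP; rewrite -bE -stable_compE stable_reprK.
by exists (stable_class b); rewrite /= stable_compE; apply/stable_classP.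
Qed.

End Resolving.

(** * Vanishing of Ext against the ring *)

Section ExtVanishing.
Variables (R : comNzRingType) (C : lmodType R -> Prop).
Hypotheses (noethR : noetherian R) (henselR : henselian_local R).
Hypotheses (subC : subcategory C) (resC : resolving C).
Hypothesis frobC : frobenius (mod_stable C).
Implicit Types X Y Z W P Q K A B : lmodType R.

Let Cfg X : C X -> fingen X := subcat_fingen subC (X := X).

Lemma lhom_from_ring X (f : lhom (R^o : lmodType R) X) (a : R^o) : f a = a *: f (1 : R).
Proof. by rewrite -linearZ /= /GRing.scale /= mulr1. Qed.

(** If the entries of [r] do not generate the unit ideal, they lie in [m], hence so do those of [b],
    and Nakayama applies to the entries of [r]. *)
Lemma row_nakayama n (r : 'rV[R]_n) (b : 'M[R]_n) :
  (forall j l, exists c : 'I_n -> R, b j l = \sum_i c i * r 0 i) ->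
  r = r *m b -> (exists c : 'I_n -> R, \sum_i c i * r 0 i = 1) \/ r = 0.
Proof.
move=> bJ rE; have [|nJ] := EM (exists c : 'I_n -> R, \sum_i c i * r 0 i = 1).
  by left.
right; have [m [idm m1 mU _]] := local_facts noethR henselR.
have mr i : m (r 0 i).
  apply: contrapT => /mU[y yE]; apply: nJ; exists (fun j => (j == i)%:R * y).
  rewrite (bigD1 i) //= eqxx mul1r mulrC yE big1 ?addr0 // => j /negbTE ->.
  by rewrite !mul0r.
have mb j l : m (b j l).
  by have [c ->] := bJ j l; apply: (ideal_sum idm) => i _; apply: ideal_mull.
have r0 i : r 0 i = 0.
  apply: (@nakayama R m idm m1 mU R^o n (fun i => r 0 i) (fun x => x = 0)) => [|l].
    by split=> // a x y -> ->; rewrite scaler0 addr0.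
  exists 0, (fun j => b j l); split=> //; rewrite add0r {1}rE mxE.
  by apply: eq_bigr => j _; rewrite mulrC.
by apply/rowP => i; rewrite r0 mxE.
Qed.

(* [Z] has projective dimension at most one.  For the universal extension [V]
   of [Z^n] by [Z], the inclusion of [Z] into [V] is stably a split
   monomorphism; read on the generators of [Z], this gives [r = r *m b] with
   the entries of [b] in the ideal generated by those of [r]. *)
Lemma unimodular_of_cokernel n (iota : lhom (R^o : lmodType R) 'rV[R]_n) Z
    (p : lhom 'rV[R]_n Z) :
  short_exact iota p -> C Z ->
  exists c : lhom 'rV[R]_n (R^o : lmodType R), c (iota (1 : R)) = 1.
Proof.
move=> [iotai ip ps] CZ; pose r := iota (1 : R).
have pr : p r = 0 by apply/ip; exists (1 : R).
have iE (a : R) : iota a = a *: r by exact: lhom_from_ring.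
pose Zn : lmodType R := {ffun 'I_n -> Z}.
pose Qn : lmodType R := {ffun 'I_n -> 'rV[R]_n}.
have lD : linear (fun x : 'rV[R]_n => [ffun j => x 0 j *: r] : Qn).
  by move=> a x y; apply/ffunP => j; rewrite !ffunE !mxE scalerDl scalerA.
pose D := mkhom lD.
have lpk : linear (fun v : Qn => [ffun j => p (v j)] : Zn).
  by move=> a x y; apply/ffunP => j; rewrite !ffunE linearP.
pose pk := mkhom lpk.
have exD : short_exact D pk.
  split.
  - apply: inj0 => x /ffunP Dx; apply/rowP => j; rewrite mxE.
    have := Dx j; rewrite !ffunE -iE => h; apply: iotai.
    by rewrite h linear0.
  - move=> v; split=> [/ffunP pv|[x <-]].
      have ex j : exists c : R^o, iota c = v j.
        by apply/ip; have := pv j; rewrite !ffunE.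
      have [c cE] := choice ex; exists (\row_j c j).
      by apply/ffunP => j; rewrite !ffunE mxE -cE iE.
    by apply/ffunP => j; rewrite !ffunE linearZ /= pr scaler0.
  - move=> z; have [v vE] := choice ps; exists [ffun j => v (z j)].
    by apply/ffunP => j; rewrite !ffunE vE.
(* The pushout of [exD] along [p]. Its [j]-th component is the pushout of the given sequence along
   the map from [R] to [Z] with value [p (delta_mx 0 j)] at 1; these classes generate Ext^1(Z,
   Z). *)
have [V [vq [vqs vqk]]] := cokernel_exists (pairh p (- D)).
pose i := hcomp vq (inlh Z Qn); pose s := hcomp vq (inrh Z Qn).
have vqD x : vq (p x, - D x) = 0 by apply/vqk; exists x.
have isD x : i (p x) = s (D x).
  apply/eqP; rewrite -subr_eq0 /= -linearB; apply/eqP; rewrite -[RHS](vqD x).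
  by congr (vq (_, _)); rewrite /= ?subr0 ?sub0r.
have [|g gE] := factor_epi (g := hcomp pk (sndh Z Qn)) vqs.
  move=> zm /vqk[x <-] /=; apply/ffunP => j; rewrite !ffunE linearN linearZ /= pr.
  by rewrite scaler0 oppr0.
have exV : short_exact i g.
  have [Di Dk pks] := exD; split.
  - apply: inj0 => z /vqk[x [<- /eqP]]; rewrite oppr_eq0 => /eqP Dx.
    by have -> : x = 0; [apply: Di; rewrite linear0; exact: Dx | rewrite linear0].
  - move=> v; split=> [gv|[z <-]]; last exact: (etrans (gE (z, 0)) (linear0 pk)).
    have [[z w] zwE] := vqs v; move: gv; rewrite -zwE gE => /Dk[x xE].
    exists (z + p x); rewrite linearD isD /= -linearD; congr (vq (_, _)).
      by rewrite /= addr0.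
    by rewrite /= add0r; exact: xE.
  - by move=> z; have [v <-] := pks z; exists (vq (0, v)); rewrite gE.
have CV : C V by apply: (C_extension subC resC exV) => //; exact: C_ffun.
have [A a _|t tE] := stable_retraction noethR subC resC frobC (g := i) CZ CV.
  apply: (stable_mono exV exD); last exact: free_projective.
  by apply: projective_ffun; exact: free_projective.
have [l [rho [pi piE]]] := stably_zero_free (Cfg CZ) tE.
have [pt ptE] := @free_projective R l _ _ p pi ps.
pose E j k : Qn := [ffun j' => if j' == j then delta_mx 0 k else 0].
have [y yE] := choice (fun jk : 'I_n * 'I_n => ps (t (s (E jk.1 jk.2)))).
pose e j : 'rV[R]_n := delta_mx 0 j.
have tD j : t (i (p (e j))) = p (\sum_k r 0 k *: y (j, k)).
  rewrite isD; have -> : D (e j) = \sum_k r 0 k *: E j k.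
    apply/ffunP => j'; rewrite sum_ffunE ffunE /e mxE eqxx /=.
    under eq_bigr do rewrite !ffunE.
    case: eqP => _ /=; first by rewrite scale1r {1}[r]row_sum_delta.
    by rewrite scale0r big1 // => k _; rewrite scaler0.
  rewrite !linear_sum; apply: eq_bigr => k _; rewrite !linearZ /=.
  by congr (_ *: _); exact/esym/yE.
(* A lift to ['rV[R]_n] of the stably zero map [hcomp t i - hid Z]. *)
pose Am x := pt (rho (p x)).
have [c cE] : exists c : 'I_n -> R^o,
    forall j, iota (c j) = e j + Am (e j) - \sum_k r 0 k *: y (j, k).
  have /choice[c cE] : forall j, exists c : R^o,
      iota c = e j + Am (e j) - \sum_k r 0 k *: y (j, k).
    move=> j; apply/ip; rewrite linearB linearD -tD ptE -piE /=.
    by rewrite addrCA subrr addr0 subrr.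
  by exists c.
pose b : 'M[R]_n := \matrix_(j, l') (\sum_k r 0 k * y (j, k) 0 l' + c j * r 0 l').
have rb : r = r *m b.
  (* Expanding both copies of [r] over the [e j] and substituting [cE] gives [r *m b]. *)
  have rE : r = r + Am r by rewrite /Am pr !linear0 addr0.
  rewrite {1}rE {1}[r]row_sum_delta -[r in Am r]/(r) {2}[r]row_sum_delta /Am !linear_sum.
  rewrite -big_split; apply/rowP => l'; rewrite summxE mxE; apply: eq_bigr => j _.
  rewrite !linearZ /= -scalerDr -/(Am (e j)) -/(e j) mxE; congr (_ * _).
  rewrite -[_ + _](subrK (\sum_k r 0 k *: y (j, k))) -cE iE !mxE summxE addrC.
  by congr (_ + _); apply: eq_bigr => k _; rewrite mxE.
have [|[d dE]|r0] := row_nakayama _ rb.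
- move=> j l'; exists (fun k => y (j, k) 0 l' + c j * (k == l')%:R).
  rewrite mxE; under [RHS]eq_bigr do rewrite mulrDl; rewrite big_split /=.
  congr (_ + _); first by apply: eq_bigr => k _; rewrite mulrC.
  rewrite (bigD1 l') //= eqxx mulr1 big1 ?addr0 // => k /negbTE ->.
  by rewrite mulr0 mul0r.
- exists (combh (X := R^o) d); rewrite -[RHS]dE; apply: eq_bigr => k _.
  by rewrite mulrC.
- have /iotai/eqP : iota (1 : R) = iota 0 by rewrite linear0.
  by rewrite (negbTE (oner_neq0 R)).
Qed.

Lemma extension_by_ring_splits X Y (iota : lhom (R^o : lmodType R) Y) (g : lhom Y X) :
  short_exact iota g -> C X ->
  exists c : lhom Y (R^o : lmodType R), c (iota (1 : R)) = 1.
Proof.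
move=> ex CX; have [iotai ig gs] := ex.
have pR : projective (R^o : lmodType R).
  move=> A B q h qs; have [a aE] := qs (h (1 : R)).
  have la : linear (fun x : R^o => (x : R) *: a).
    by move=> x y z; rewrite scalerDl scalerA.
  by exists (mkhom la) => x /=; rewrite linearZ /= aE [RHS]lhom_from_ring.
have CR : C (R^o : lmodType R).
  apply: (subcat_proj subC) => //; exists 1%N, (fun=> (1 : R)) => x.
  by exists (fun=> x); rewrite big_ord1 /GRing.scale /= mulr1.
have CY := C_extension subC resC ex CR CX.
have [A a _|s sE] := stable_retraction noethR subC resC frobC (g := g) CY CX.
  exact: (stable_mono_proj pR ex).
have [n [rho [pi piE]]] := stably_zero_free (Cfg CY) sE.
pose Q : lmodType R := 'rV[R]_n.
have [Z [zq [zqs zqk]]] := cokernel_exists (pairh g (- rho)).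
(* Adding the free module through which [hcomp s g - hid Y] factors makes the stable splitting
   strict. *)
have retr y : copairh s pi (pairh g (- rho) y) = y.
  by rewrite /= linearN -piE /= opprB addrC subrK.
have exZ : short_exact (pairh g (- rho)) zq.
  by split=> //; apply: (can_inj retr).
have [_ CZ] := C_split subC exZ retr (C_prod subC CX (C_free subC n)).
have exQ : short_exact (- hcomp rho iota) (hcomp zq (inrh X Q)).
  split.
  - apply: inj0 => x /= xE; apply: iotai; rewrite linear0 -(retr (iota x)).
    have -> : pairh g (- rho) (iota x) = 0.
      by rewrite /= xE; congr (_, _); apply/ig; exists x.
    exact: linear0.
  - move=> q; split=> [/zqk[y [/ig[x <-] <-]]|[x <-]]; first by exists x.
    apply/zqk; exists (iota x); congr (_, _); apply/ig; by exists x.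
  - move=> z; have [[x q] <-] := zqs z; have [y yE] := gs x.
    exists (q + rho y); apply/eqP; rewrite -subr_eq0 /= -linearB; apply/eqP/zqk.
    exists (- y); rewrite /= !linearN yE opprK; congr (_, _).
      by rewrite /= sub0r.
    by rewrite /= addrAC subrr add0r.
have [c cE] := unimodular_of_cokernel exQ CZ.
by exists (hcomp c (- rho)).
Qed.

(** The pushout along [f] is an extension of [X] by [R]; a retraction of it, restricted to [P],
    extends [f]. This is the form in which Ext^1(X, R) = 0 is used later. *)
Lemma hom_to_ring_extends X K P (i : lhom K P) (p : lhom P X) (f : lhom K (R^o : lmodType R)) :
  short_exact i p -> C X -> exists F : lhom P (R^o : lmodType R), forall k, F (i k) = f k.
Proof.
move=> [ii ip ps] CX.
have [Y [q [qs qk]]] := cokernel_exists (pairh f (- i)).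
pose iota := hcomp q (inlh (R^o : lmodType R) P).
pose j := hcomp q (inrh (R^o : lmodType R) P).
have ji k : j (i k) = iota (f k).
  apply/eqP; rewrite eq_sym -subr_eq0 /= -linearB; apply/eqP/qk; exists k.
  by congr (_, _); rewrite /= ?subr0 ?sub0r.
have [|g gE] := factor_epi (g := hcomp p (sndh (R^o : lmodType R) P)) qs.
  move=> x /qk[k <-] /=; rewrite linearN; apply/eqP; rewrite oppr_eq0.
  by apply/eqP/ip; exists k.
have ex : short_exact iota g.
  split.
  - apply: inj0 => a /qk[k [<- /eqP]]; rewrite oppr_eq0 => /eqP ik.
    by have -> : k = 0; [apply: ii; rewrite linear0; exact: ik | rewrite linear0].
  - move=> y; split=> [|[a <-]]; last exact: (etrans (gE (a, 0)) (linear0 p)).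
    have [[a x] <-] := qs y; rewrite gE => /ip[k kE]; exists (a + f k).
    rewrite linearD -ji /= -linearD; congr (q (_, _)); first by rewrite /= addr0.
    by rewrite /= add0r.
  - by move=> x; have [x' <-] := ps x; exists (q (0, x')); rewrite gE.
have [c cE] := extension_by_ring_splits ex CX.
exists (hcomp c j) => k; rewrite -[LHS]/(c (j (i k))) ji.
have -> : c (iota (f k)) = hcomp c iota (f k) by [].
by rewrite lhom_from_ring /hcomp /= cE /GRing.scale /= mulr1.
Qed.

Lemma hom_to_free_extends X K P n (i : lhom K P) (p : lhom P X) (f : lhom K 'rV[R]_n) :
  short_exact i p -> C X -> exists F : lhom P 'rV[R]_n, forall k, F (i k) = f k.
Proof.
move=> ex CX.
have lc l : linear (fun v : 'rV[R]_n => v 0 l : R^o) by move=> a x y; rewrite !mxE.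
have [F FE] := choice (fun l => hom_to_ring_extends (hcomp (mkhom (lc l)) f) ex CX).
have lF : linear (fun x => \row_l (F l x : R)).
  by move=> a x y; apply/rowP => l; rewrite !mxE linearP.
by exists (mkhom lF) => k; apply/rowP => l; rewrite mxE FE.
Qed.

End ExtVanishing.

(** * Cosyzygies *)

Section Cosyzygies.
Variables (R : comNzRingType) (C : lmodType R -> Prop).
Hypotheses (noethR : noetherian R) (henselR : henselian_local R).
Hypotheses (subC : subcategory C) (resC : resolving C).
Hypothesis frobC : frobenius (mod_stable C).
Hypothesis extC : ~ exists X : lmodType R,
  [/\ C X, ~ projective X & Ext1_functor_zero C X].
Implicit Types X Y Z W P Q K A B : lmodType R.

Let Cfg X : C X -> fingen X := subcat_fingen subC (X := X).

Definition has_cosyzygy X : Prop :=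
  exists P X1 (i : lhom X P) (p : lhom P X1),
    [/\ fingen P, projective P, short_exact i p & C X1].

Lemma has_cosyzygy_projective X : fingen X -> projective X -> has_cosyzygy X.
Proof.
move=> fX pX; exists X, 'rV[R]_0, (hid X), (lhom0 _ _); split=> //; last exact: C_free.
split=> // [x|y]; first by split=> // _; exists x.
by exists 0; rewrite (thinmx0 y).
Qed.

Lemma has_cosyzygy_split X N M (i : lhom N X) (g : lhom X M) (r : lhom X N) :
  short_exact i g -> (forall x, r (i x) = x) ->
  has_cosyzygy N -> has_cosyzygy M -> has_cosyzygy X.
Proof.
move=> ex ri [P [N1 [iN [pN [fP pP [iNi iNp pNs] CN1]]]]].
move=> [Q [M1 [iM [pM [fQ pQ [iMi iMp pMs] CM1]]]]].
have [rgi rgs] := split_bijective ex ri.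
exists (P * Q)%type, (N1 * M1)%type, (pairh (hcomp iN r) (hcomp iM g)),
  (pairh (hcomp pN (fsth P Q)) (hcomp pM (sndh P Q))).
split; [exact: fingen_prod | exact: projective_prod | | exact: C_prod].
split.
- by move=> x y [/iNi rxy /iMi gxy]; apply: rgi; congr (_, _).
- move=> [a b]; split=> [[/iNp[n nE] /iMp[m mE]]|[x [<- <-]]].
    by have [x [rx gx]] := rgs (n, m); exists x => /=; rewrite rx gx nE mE.
  congr (_, _); first by apply/iNp; exists (r x).
  by apply/iMp; exists (g x).
- move=> [n m]; have [a <-] := pNs n; have [b <-] := pMs m.
  by exists (a, b).
Qed.

(** [P/N] is an extension of [V = P/U] by [U/N], and [U/N] is a direct summand of [U]. *)
Lemma has_cosyzygy_retract N U P V (al : lhom N U) (be : lhom U N)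
    (j : lhom U P) (p : lhom P V) :
  (forall x, be (al x) = x) -> fingen P -> projective P -> short_exact j p ->
  C U -> C V -> has_cosyzygy N.
Proof.
move=> ba fP pP [ji jp ps] CU CV.
have ali : injective al := can_inj ba.
have [D [d [ds dk]]] := cokernel_exists al.
have exD : short_exact al d by split.
have [_ CD] := C_split subC exD ba CU.
have [X1 [q [qs qk]]] := cokernel_exists (hcomp j al).
exists P, X1, (hcomp j al), q; split=> //; first by split=> //; exact: inj_comp.
have [|u uE] := factor_epi (g := hcomp q j) ds.
  by move=> x /dk[n <-]; apply/qk; exists n.
have [|v vE] := factor_epi (g := p) qs.
  by move=> x /qk[n <-]; apply/jp; exists (al n).
apply: (C_extension subC resC (i := u) (g := v) _ CD CV); split.
- apply: inj0 => z; have [x <-] := ds z; rewrite uE => /qk[n /ji nE].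
  by apply/dk; exists n.
- move=> z; have [x <-] := qs z; rewrite vE; split=> [/jp[y yE]|[w]].
    by exists (d y); rewrite uE /= yE.
  have [y <-] := ds w; rewrite uE => /eqP; rewrite eq_sym -subr_eq0 /= -linearB.
  move=> /eqP/qk[n nE]; apply/jp; exists (y + al n).
  by rewrite linearD /= [j (al n)]nE addrC subrK.
- by move=> w; have [x <-] := ps w; exists (q x); rewrite vE.
Qed.

(** A cocycle that is not a coboundary induces [phi] on the first syzygy of [W]. If [phi] factored
    through a free module, the map into that module would extend to [P], making the cocycle a
    coboundary. *)
Lemma nonprojective_syzygy_map X : C X -> ~ projective X ->
  exists W K P (i : lhom K P) (p : lhom P W) (phi : lhom K X),
    [/\ C W, C K, fingen P /\ projective P, short_exact i p & ~ stably_zero phi].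
Proof.
move=> CX pX.
have /existsNP[W /not_implyP[CW]] : ~ Ext1_functor_zero C X.
  by move=> h; apply: extC; exists X.
move=> /existsNP[res /existsNP[f /not_implyP[fc fnb]]].
have [K [i [ii ik]]] := kernel_exists (res_aug res).
have ex : short_exact i (res_aug res) by split=> //; exact: res_aug_surj.
have fP : fingen (res_ob res 0) := @res_fingen _ _ res 0.
have pP : projective (res_ob res 0) := @res_projective _ _ res 0%N.
have CP : C (res_ob res 0) := subcat_proj subC fP pP.
have CK := C_kernel noethR subC resC ex CP CW.
have [|d dE] := @lift_mono _ _ K _ i (res_d res 0) ii.
  by move=> x; apply/ik/res_exact0; exists x.
have ds : surjective_map d.
  move=> k; have /res_exact0[x xE] : res_aug res (i k) = 0 by apply/ik; exists k.
  by exists x; apply: ii; rewrite dE.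
have [|phi phiE] := factor_epi (g := f) ds.
  move=> x dx; have /res_exactS[y <-] : res_d res 0 x = 0 by rewrite -dE dx linear0.
  exact: fc.
exists W, K, (res_ob res 0), i, (res_aug res), phi; split=> // szphi.
apply: fnb; have [n [a [b phiab]]] := stably_zero_free (Cfg CX) szphi.
have [F FE] := hom_to_free_extends noethR henselR subC resC frobC a ex CW.
by exists (hcomp b F) => x; rewrite -phiE phiab /= -dE FE.
Qed.

(* The cokernel of [Hom(-, Y) -> Hom(-, W)], for the pushout [Y] of
   [0 -> K -> P -> W -> 0] along [phi], embeds into some [Hom(-, V)].  Taking
   syzygies, the images of [Hom(-, K)] under [phi] and under [K -> KV] are
   isomorphic, so that injectivity of representables yields both [al] and [be]. *)
Lemma factor_through_syzygy X W K P (i : lhom K P) (p : lhom P W) (phi : lhom K X) :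
  C X -> C W -> C K -> fingen P -> projective P -> short_exact i p ->
  exists V KV n (iV : lhom KV 'rV[R]_n) (pV : lhom 'rV[R]_n V)
    (al : lhom X KV) (be : lhom KV X),
    [/\ C V, C KV, short_exact iV pV & stably_zero (hcomp (hcomp be al) phi - phi)].
Proof.
move=> CX CW CK fP pP ex; have [ii ip ps] := ex.
have CP : C P by exact: (subcat_proj subC).
have [Y [qY [qYs qYk]]] := cokernel_exists (pairh phi (- i)).
have [|g gE] := factor_epi (g := hcomp p (sndh X P)) qYs.
  move=> x /qYk[k <-] /=; rewrite linearN; apply/eqP; rewrite oppr_eq0.
  by apply/eqP/ip; exists k.
have exY : short_exact (hcomp qY (inlh X P)) g.
  split.
  - apply: inj0 => x /qYk[k [<- /eqP]]; rewrite oppr_eq0 => /eqP ik.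
    by have -> : k = 0; [apply: ii; rewrite linear0; exact: ik | rewrite linear0].
  - move=> y; split=> [|[x <-]]; last exact: (etrans (gE (x, 0)) (linear0 p)).
    have [[x z] <-] := qYs y; rewrite gE => /ip[k kE]; exists (x + phi k).
    apply/eqP; rewrite -subr_eq0 /= -linearB; apply/eqP/qYk; exists k.
    congr (_, _); first by rewrite /= addrC addrA addNr add0r.
    by rewrite /= sub0r; congr (- _).
  - by move=> w; have [x <-] := ps w; exists (qY (0, x)); rewrite gE.
have CY := C_extension subC resC exY CX CW.
(* the syzygy of Y is the weak kernel of phi *)
have [nX [pi pis]] := free_cover (Cfg CX); pose PX : lmodType R := 'rV[R]_nX.
have pPX : projective PX by exact: free_projective.
have [K1 [i1 ex1]] := copairh_kernel phi pis.
pose kap := hcomp (sndh _ _) i1.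
have kapP := weak_kernelP pPX pis ex1.
pose c : lhom (PX * P)%type Y := hcomp qY (pairh (hcomp pi (fsth PX P)) (sndh PX P)).
pose j := pairh (hcomp (fsth _ _) i1) (hcomp i kap).
have [i1i i1k _] := ex1.
have K1E x : pi (i1 x).1 + phi (i1 x).2 = 0 by apply/(i1k (i1 x)); exists x.
have exc : short_exact j c.
  split.
  - by move=> x y [h1 /ii h2]; apply: i1i; rewrite [i1 x]surjective_pairing h1 h2 -surjective_pairing.
  - move=> [a z]; split=> [/qYk[k [kE1 kE2]]|[x [<- <-]]].
      have /i1k[x xE] : copairh pi phi (a, - k) = 0.
        by rewrite /= linearN -kE1 subrr.
      by exists x; rewrite /= xE /= linearN kE2.
    apply/qYk; exists (- (i1 x).2); congr (_, _).
      by rewrite /= linearN; apply/eqP; rewrite eq_sym -addr_eq0; apply/eqP; exact: K1E.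
    by rewrite /= linearN opprK.
  - move=> y; have [[x z] <-] := qYs y; have [a aE] := pis x.
    by exists (a, z); rewrite /= aE.
(* [kE] makes [g] a weak kernel of [k]: one half gives [szkg], the other the map [mu]. *)
have [V [k [CV kE]]] := weak_cokernel frobC g CY CW.
have [n [pV pVs]] := free_cover (Cfg CV).
have [KV [iV [iVi iVk]]] := kernel_exists pV.
have exV : short_exact iV pV by split.
have CKV := C_kernel noethR subC resC exV (C_free subC n) CV.
have [kt ktE] := pP _ _ pV (hcomp k p) pVs.
have [|ok okE] := @lift_mono _ K KV _ iV (hcomp kt i) iVi.
  move=> x; apply/iVk; rewrite /= ktE /=; have -> : p (i x) = 0 by apply/ip; exists x.
  exact: linear0.
have szkg : stably_zero (hcomp k g).
  apply/kE => //; exists (hid Y); by apply: stably_zero0 => x; exact: subrr.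
have szphikap : stably_zero (hcomp phi kap).
  apply/kapP; exists (hid K1); by apply: stably_zero0 => x; exact: subrr.
have szokkap : stably_zero (hcomp ok kap).
  apply: (syzygy_stably_zero (F := hcomp kt (sndh PX P)) exc exV _ _ _ szkg).
  - exact: projective_prod.
  - by move=> x; rewrite /= ktE /= gE.
  - by move=> x; rewrite /= okE.
have phi_ok A (a : lhom A K) : C A -> stably_zero (hcomp phi a) -> stably_zero (hcomp ok a).
  move=> _ /kapP[z zE].
  have -> : hcomp ok a = hcomp (hcomp ok kap) z - hcomp ok (hcomp kap z - a).
    by rewrite hcompBr hcompA opprB addrC subrK.
  by apply: stably_zeroB; [exact: stably_zero_compr | exact: stably_zero_compl].
(* The weak kernel [M] of [ok] is a syzygy of the weak kernel [L] of [k]. The map [mu] induces [m0]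
   from [M] to [K1] on syzygies, so [kM] is stably [hcomp kap m0] up to sign, and [phi] kills it
   stably. *)
have ok_phi A (a : lhom A K) : C A -> stably_zero (hcomp ok a) -> stably_zero (hcomp phi a).
  have [n' [p' p's]] := free_cover (Cfg CKV); pose P' : lmodType R := 'rV[R]_n'.
  have pP' : projective P' by exact: free_projective.
  have [M [iM exM]] := copairh_kernel ok p's; have [iMi iMk _] := exM.
  pose kM := hcomp (sndh P' K) iM.
  have [L [iL exL]] := copairh_kernel k pVs; have [iLi iLk _] := exL.
  pose lam := hcomp (sndh _ _) iL.
  have CL : C L by apply: (C_kernel noethR subC resC exL) => //; exact: C_prod (C_free subC n) CW.
  have szklam : stably_zero (hcomp k lam).
    apply/(weak_kernelP (@free_projective R n) pVs exL); exists (hid L).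
    by apply: stably_zero0 => x; exact: subrr.
  have [mu muE] : exists mu : lhom L Y, stably_zero (hcomp g mu - lam) by apply/kE.
  pose mL : lhom (P' * P)%type ('rV[R]_n * W)%type :=
    pairh (copairh (hcomp iV p') (- kt)) (hcomp p (sndh P' P)).
  have pViV x : pV (iV x) = 0 by apply/iVk; exists x.
  have [|cL cLE] := @lift_mono _ _ L _ iL mL iLi.
    by move=> x; apply/iLk; rewrite /= linearD linearN pViV ktE /= add0r addNr.
  (* [M] consists of pairs with [p' y' + ok y = 0], whereas [mL] vanishes where the two terms are
     equal; the sign reconciles them and reappears in [szM]. *)
  pose jM := pairh (hcomp (fsth P' K) iM) (- hcomp i kM).
  have ME x : p' (iM x).1 + ok (iM x).2 = 0 by apply/(iMk (iM x)); exists x.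
  have exM' : short_exact jM cL.
    split.
    - move=> x y [h1 /oppr_inj/ii h2]; apply: iMi.
      by rewrite [iM x]surjective_pairing h1 [X in (_, X)]h2 -surjective_pairing.
    - move=> [y' z]; split=> [cz|[x [<- <-]]].
        have mL0 : mL (y', z) = 0 by rewrite -cLE cz linear0.
        have /ip[y yE] : p z = 0 by exact: (congr1 snd mL0).
        have h1 : iV (p' y') - kt z = 0 by exact: (congr1 fst mL0).
        have /iMk[x xE] : copairh p' ok (y', - y) = 0.
          apply: iVi; rewrite [RHS]linear0 -[RHS]h1 -yE -[kt (i y)]okE.
          by rewrite -linearB; congr (iV _); rewrite /= linearN.
        by exists x; rewrite /jM /kM /= xE /= linearN opprK yE.
      apply: iLi; rewrite cLE linear0; congr (_, _); rewrite /=.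
        by rewrite !linearN opprK -[kt _]okE -linearD ME linear0.
      by rewrite linearN; apply/eqP; rewrite oppr_eq0; apply/eqP/ip; exists (kM x).
    - move=> l; have : pV (iL l).1 + k (iL l).2 = 0 by apply/(iLk (iL l)); exists l.
      have [z zE] := ps (iL l).2; rewrite -zE -[k (p z)]ktE -linearD => /iVk[y yE].
      have [y' y'E] := p's y; exists (y', z); apply: iLi; rewrite cLE.
      by rewrite [RHS]surjective_pairing; congr (_, _) => //=; rewrite y'E yE addrK.
  have pPP : projective (P' * P)%type by exact: projective_prod.
  have [cs cj ci] := exc.
  have [mt mtE] := pPP _ _ c (hcomp mu cL) ci.
  have [|m0 m0E] := @lift_mono _ M K1 _ j (hcomp mt jM) cs.
    move=> x; apply/cj; apply: (etrans (mtE (jM x))).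
    have h : cL (jM x) = 0 by have [_ h _] := exM'; apply/h; exists x.
    exact: (etrans (congr1 mu h) (linear0 mu)).
  have szM : stably_zero (hcomp kap m0 + kM).
    apply: (syzygy_stably_zero (F := hcomp (sndh _ _) mt - sndh _ _) exM' ex pPP _ _ muE).
    - move=> x; rewrite /= linearB; congr (_ - _).
        exact: (etrans (esym (gE _)) (congr1 g (mtE x))).
      by have := cLE x => /(congr1 snd) /= ->.
    - move=> x; rewrite linearD /= opprK; congr (_ + _).
      by have := m0E x => /(congr1 snd).
  move=> CA /(weak_kernelP pP' p's exM)[z zE].
  have -> : hcomp phi a = hcomp (hcomp phi (hcomp kap m0 + kM)) z
      - hcomp (hcomp (hcomp phi kap) m0) z - hcomp phi (hcomp kM z - a).
    apply: lhom_ext => x.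
    have alg (u v t : X) : t = u + v - u - (v - t).
      by rewrite [u + v]addrC addrK opprB addrC subrK.
    rewrite [LHS](alg (phi (kap (m0 (z x)))) (phi (kM (z x)))).
    by rewrite -[_ - phi (a x)](linearB phi) -[_ + phi (kM _)](linearD phi).
  apply: stably_zeroB; last exact: stably_zero_compl.
  by apply: stably_zeroB; apply: stably_zero_compr; [exact: stably_zero_compl | exact: stably_zero_compr].
have [al alE] := extension_of_stable_maps noethR subC resC frobC CK CX CKV phi_ok.
have [be beE] := extension_of_stable_maps noethR subC resC frobC CK CKV CX ok_phi.
exists V, KV, n, iV, pV, al, be; split=> //.
have -> : hcomp (hcomp be al) phi - phi =
    hcomp be (hcomp al phi - ok) + (hcomp be ok - phi).
  by rewrite hcompBr hcompA addrA subrK.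
by apply: stably_zeroD => //; exact: stably_zero_compl.
Qed.

Lemma nonprojective_summand X : C X -> ~ projective X ->
  exists N M (i : lhom N X) (g : lhom X M) (r : lhom X N),
    [/\ short_exact i g, forall x, r (i x) = x, has_cosyzygy N &
        exists x : N, x <> 0].
Proof.
move=> CX pX.
have [W [K [P [i [p [phi [CW CK [fP pP] ex nsz]]]]]]] := nonprojective_syzygy_map CX pX.
have [V [KV [n [iV [pV [al [be [CV CKV exV szbe]]]]]]]] :=
  factor_through_syzygy phi CX CW CK fP pP ex.
pose e := hcomp be al.
have [f [c [d [ff cef dE]]]] := fitting noethR henselR e (Cfg CX).
have [N [iN [iNi iNk]]] := kernel_exists (hid X - f).
have fN x : f (iN x) = iN x.
  have /eqP : (hid X - f) (iN x) = 0 by apply/iNk; exists x.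
  by rewrite /= subr_eq0 => /eqP.
have [x|r rE] := @lift_mono _ X N X iN f iNi.
  by apply/iNk; rewrite /= ff subrr.
have [M [iM [iMi iMk]]] := kernel_exists f.
have [x|g gE] := @lift_mono _ X M X iM (hid X - f) iMi.
  by apply/iMk; rewrite /= linearB ff subrr.
exists N, M, iN, g, r; split.
- split=> //.
    move=> x; split=> [gx|[y <-]].
      by apply/iNk; rewrite -gE gx linear0.
    by apply: iMi; rewrite gE /= fN subrr linear0.
  move=> y; exists (iM y); apply: iMi; rewrite gE /=.
  by have -> : f (iM y) = 0; [apply/iMk; exists y | rewrite subr0].
- by move=> x; apply: iNi; rewrite rE fN.
(* On [N] the map [c] undoes [e = hcomp be al], so [hcomp c be] followed by the projection is a left
   inverse of [hcomp al iN]. *)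
- have [|be' be'E] := @lift_mono _ KV N X iN (hcomp f (hcomp c be)) iNi.
    by move=> y; apply/iNk; rewrite /= ff subrr.
  apply: (has_cosyzygy_retract (al := hcomp al iN) (be := be') _ _ _ exV CKV CV).
  + move=> x; apply: iNi; rewrite be'E /= -{1}[iN x]fN.
    by rewrite [c _](cef (iN x)) ff fN.
  + exact: free_fingen.
  + exact: free_projective.
(* If [N] were zero, [d] would be a left inverse of [id - e] on all of [X], and [phi] would be
   stably zero because [phi - hcomp e phi] is. *)
- apply: contrapT => /forallNP N0; apply: nsz.
  have f0 x : f x = 0 by rewrite -rE; have /contrapT -> := N0 (r x); rewrite linear0.
  have -> : phi = hcomp d (- (hcomp e phi - phi)).
    apply: lhom_ext => x; have := dE (phi x).
    by rewrite f0 subr0 /= opprB.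
  by apply: stably_zero_compl; exact: stably_zeroN.
Qed.

(** Among the quotients of [X] that lie in [C] and lack a cosyzygy, take one with maximal kernel.
    Dividing out its nonzero summand with a cosyzygy leaves another such quotient, with a larger
    kernel. *)
Lemma all_have_cosyzygies X : C X -> has_cosyzygy X.
Proof.
move=> CX; apply: contrapT => bad.
pose F (N : X -> Prop) := exists Y (s : lhom X Y),
  [/\ C Y, ~ has_cosyzygy Y, surjective_map s & N = (fun x => s x = 0)].
have [||N [[Y [s [CY badY ss NE]]] Nmax]] :=
    noetherian_max noethR (X := X) (F := F) (N0 := fun x => x = 0) (Cfg CX).
- move=> _ [Y [s [_ _ _ ->]]]; split=> [|a x y]; first exact: linear0.
  by rewrite linearP => -> ->; rewrite scaler0 addr0.
- by exists X, (hid X); split=> // x; exists x.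
have npY : ~ projective Y.
  by move=> pY; apply: badY; apply: has_cosyzygy_projective => //; exact: Cfg.
have [A [B [i [g [r [ex ri gA [a a0]]]]]]] := nonprojective_summand CY npY.
have [_ CB] := C_split subC ex ri CY; have [ii ig gs] := ex.
have badB : ~ has_cosyzygy B by move=> gB; apply/badY/(has_cosyzygy_split ex ri).
have [x xE] := ss (i a).
have gx : g (s x) = 0 by apply/ig; exists a.
have : N x.
  apply: (Nmax (fun y => hcomp g s y = 0)) gx.
    exists B, (hcomp g s); split=> // y; have [z <-] := gs y.
    by have [w <-] := ss z; exists w.
  by move=> y; rewrite NE /= => ->; rewrite linear0.
by rewrite NE xE => /eqP; rewrite -(linear0 i) => /eqP/ii.
Qed.

End Cosyzygies.

(** * Transposes *)

Section Duals.
Variable R : comNzRingType.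
Implicit Types P Q X Y : lmodType R.

Lemma projective_basis P : fingen P -> projective P ->
  exists n (b : 'I_n -> P) (s : 'I_n -> dual P), forall x, x = \sum_i s i x *: b i.
Proof.
move=> fP pP; have [n [p ps]] := free_cover fP.
have [s sE] := pP _ _ p (hid P) ps.
have lc i : linear (fun v : 'rV[R]_n => v 0 i : R^o) by move=> a x y; rewrite !mxE.
exists n, (fun i => p (delta_mx 0 i)), (fun i => hcomp (mkhom (lc i)) s) => x.
by rewrite -[LHS](sE x) row_combh.
Qed.

Lemma projective_retract P Q (u : lhom P Q) (v : lhom Q P) :
  (forall x, v (u x) = x) -> projective Q -> projective P.
Proof.
move=> vu pQ Y Z g h gs; have [k kE] := pQ _ _ g (hcomp h v) gs.
by exists (hcomp k u) => x; rewrite /= kE /= vu.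
Qed.

Lemma dual_basis P n (b : 'I_n -> P) (s : 'I_n -> dual P) (phi : dual P) :
  (forall x, x = \sum_i s i x *: b i) -> phi = \sum_i (phi (b i) : R) *: s i.
Proof.
move=> bs; apply: lhom_ext => x.
have ev (r : seq 'I_n) (F : 'I_n -> dual P) : (\sum_(i <- r) F i) x = \sum_(i <- r) F i x.
  by elim/big_rec2: _ => //= i _ z _ <-.
rewrite ev {1}(bs x) linear_sum; apply: eq_bigr => i _.
by rewrite linearZ /= /GRing.scale /= mulrC.
Qed.

Lemma dual_fingen_projective P : fingen P -> projective P ->
  fingen (dual P) /\ projective (dual P).
Proof.
move=> fP pP; have [n [b [s bs]]] := projective_basis fP pP.
split; first by exists n, s => phi; exists (fun i => phi (b i)); exact: dual_basis.
have lu : linear (fun phi : dual P => \row_i (phi (b i) : R)).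
  by move=> a x y; apply/rowP => i; rewrite !mxE.
apply: (@projective_retract _ _ (mkhom lu) (combh s)); last exact: free_projective.
move=> phi; rewrite [RHS](dual_basis phi bs); apply: eq_bigr => i _.
by rewrite mxE.
Qed.

(** The surjective half of reflexivity; [dual_separates] is the injective half. *)
Lemma dual_reflexive P (xi : lhom (dual P) (R^o : lmodType R)) :
  fingen P -> projective P -> exists x : P, forall phi : dual P, xi phi = phi x.
Proof.
move=> fP pP; have [n [b [s bs]]] := projective_basis fP pP.
exists (\sum_i (xi (s i) : R) *: b i) => phi.
rewrite {1}(dual_basis phi bs) !linear_sum; apply: eq_bigr => i _.
by rewrite !linearZ /= /GRing.scale /= mulrC.
Qed.

Lemma dual_separates P (x : P) : fingen P -> projective P ->
  (forall phi : dual P, phi x = 0) -> x = 0.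
Proof.
move=> fP pP h; have [n [b [s bs]]] := projective_basis fP pP.
by rewrite (bs x) big1 // => i _; rewrite h scale0r.
Qed.

End Duals.

(** * Dimension shifting *)

Section ExtOfClass.
Variables (R : comNzRingType) (D : lmodType R -> Prop).
Implicit Types K P M : lmodType R.
Hypothesis Dsyz : forall K P M (i : lhom K P) (p : lhom P M),
  D M -> fingen P -> projective P -> short_exact i p -> D K.
Hypothesis Dext : forall K P M (i : lhom K P) (p : lhom P M) (f : lhom K (R^o : lmodType R)),
  D M -> fingen P -> projective P -> short_exact i p ->
  exists F : lhom P (R^o : lmodType R), forall k, F (i k) = f k.

Lemma Ext_zero_of_class M n : D M -> Ext_zero n.+1 M (R^o : lmodType R).
Proof.
move=> DM P f fc.
(* [Q] is the [n]-th syzygy of [M] in the given resolution and [K] the next one. A cocycle descends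
   along [d] to a functional on [K], and its extension to [res_ob P n] exhibits a coboundary. *)
have [Q [K [i [c [d [DQ ex ds dE]]]]]] : exists Q K (i : lhom K (res_ob P n))
    (c : lhom (res_ob P n) Q) (d : lhom (res_ob P n.+1) K),
    [/\ D Q, short_exact i c, surjective_map d & forall x, i (d x) = res_d P n x].
  elim: n {f fc} => [|n [Q [K [i [c [d [DQ ex ds dE]]]]]]].
    have [K [i [ii ik]]] := kernel_exists (res_aug P).
    have [x|d dE] := lift_mono (i := i) (g := res_d P 0) ii.
      by apply/ik/res_exact0; exists x.
    exists M, K, i, (res_aug P), d; split=> //.
      by split=> //; exact: res_aug_surj.
    move=> k; have /res_exact0[x xE] : res_aug P (i k) = 0 by apply/ik; exists k.
    by exists x; apply: ii; rewrite dE.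
  have [K' [i' [ii' ik']]] := kernel_exists d.
  have [ii _ _] := ex.
  have dk x : d x = 0 <-> res_d P n x = 0.
    by split=> [h|h]; [rewrite -dE h linear0 | apply: ii; rewrite dE h linear0].
  have [x|d' dE'] := lift_mono (i := i') (g := res_d P n.+1) ii'.
    by apply/ik'/dk/res_exactS; exists x.
  exists K, K', i', d, d'; split=> //.
    by apply: (Dsyz DQ _ _ ex); [exact: res_fingen | exact: res_projective].
  move=> k; have /dk/res_exactS[x xE] : d (i' k) = 0 by apply/ik'; exists k.
  by exists x; apply: ii'; rewrite dE'.
have [x dx|g gE] := factor_epi (g := f) ds.
  have /res_exactS[y <-] : res_d P n x = 0 by rewrite -dE dx linear0.
  exact: fc.
have [F FE] := Dext g DQ (@res_fingen _ _ P n) (@res_projective _ _ P n) ex.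
by exists F => x; rewrite -gE -FE dE.
Qed.

End ExtOfClass.

Section Transposes.
Variables (R : comNzRingType) (C : lmodType R -> Prop).
Implicit Types X Y Z K P M T Q : lmodType R.
Hypothesis Cfg : forall X, C X -> fingen X.
Hypothesis Cext : forall X K P (i : lhom K P) (p : lhom P X)
    (f : lhom K (R^o : lmodType R)), short_exact i p -> C X ->
  exists F : lhom P (R^o : lmodType R), forall k, F (i k) = f k.
Hypothesis Ccos : forall X, C X -> has_cosyzygy C X.

(** Following [e] by the embedding [j] of [X] gives a presentation of the cosyzygy [X1] by [P0] and
    [P]. Its dual is exact at [dual P0]: a functional killing the image of [d] descends to [X] and
    extends to [P] since Ext^1(X1, R) = 0. So the image of [dual_map d] is a transpose of [X1]. *)
Lemma transpose_syzygy X T : C X -> is_transpose X T ->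
  exists X1 K P (i : lhom K P) (q : lhom P T),
    [/\ C X1 /\ is_transpose X1 K, fingen P, projective P, short_exact i q &
     forall f : lhom K (R^o : lmodType R),
       exists F : lhom P (R^o : lmodType R), forall k, F (i k) = f k].
Proof.
move=> CX [P1 [P0 [d [e [[fP1 pP1] [fP0 pP0] de es [q [dq qs]]]]]]].
have [P [X1 [j [p [fP pP [ji jp ps] CX1]]]]] := Ccos CX.
have [fD1 pD1] := dual_fingen_projective fP1 pP1.
have [K [i [ii ik]]] := kernel_exists q.
have [phi|dk dkE] := lift_mono (i := i) (g := dual_map d) ii.
  by apply/ik/dq; exists phi.
have dks : surjective_map dk.
  move=> k; have /dq[phi phiE] : q (i k) = 0 by apply/ik; exists k.
  by exists phi; apply: ii; rewrite dkE.
exists X1, K, (dual P1), i, q; split=> //.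
  split=> //; exists P0, P, (hcomp j e), p; split=> //.
    move=> x; split=> [/jp[y yE]|[z <-]].
      by have [z zE] := es y; exists z; rewrite /= zE.
    by apply/jp; exists (e z).
  exists dk; split=> // phi; split=> [dk0|[chi <-]].
    have phid x : phi (d x) = 0.
      have : dual_map d phi = 0 by rewrite -dkE dk0 linear0.
      by move/(congr1 (fun g : dual P1 => g x)).
    have e0 x : e x = 0 -> phi x = 0 by move=> /de[y <-]; exact: phid.
    have [psi psiE] := factor_epi es e0.
    have [chi chiE] := Cext psi (And3 ji jp ps) CX1.
    by exists chi; apply: lhom_ext => x; rewrite /= chiE psiE.
  apply: ii; rewrite dkE linear0; apply: lhom_ext => x /=.
  by have -> : e (d x) = 0; [apply/de; exists x | rewrite !linear0].
(* Pulled back to [dual P0], [f] is evaluation at some [a]. It kills what comes from [dual P], so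
   [a] dies in [P], hence in [X], and [a = d b]; evaluation at [b] extends [f]. *)
move=> f; have [a aE] := dual_reflexive (hcomp f dk) fP0 pP0.
have /de[b bE] : e a = 0.
  apply: ji; rewrite linear0; apply: dual_separates => // psi.
  have := aE (hcomp psi (hcomp j e)) => /= <-.
  have -> : dk (hcomp psi (hcomp j e)) = 0.
    apply: ii; rewrite dkE linear0; apply: lhom_ext => x /=.
    by have -> : e (d x) = 0; [apply/de; exists x | rewrite !linear0].
  exact: linear0.
have le : linear (fun phi : dual P1 => phi b : R^o) by [].
exists (mkhom le) => k; have [phi <-] := dks k.
by rewrite /= dkE /= bE -aE.
Qed.

(* Transposes and syzygies are only determined up to projective summands, so
   the class to close under syzygies is that of the stable retracts. *)
Definition transpose_retract M : Prop :=
  exists X T (u : lhom M T) (v : lhom T M),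
    [/\ C X, is_transpose X T & stably_zero (hcomp v u - hid M)].

(** On syzygies [hcomp v0 u0 - hid K] is not only stably zero but of the form [hcomp w i]. Hence [f]
    is [f v0 u0] minus [f w i]; the first term extends through [G], the second visibly extends to
    [P]. *)
Lemma retract_syzygy K P M K' P' T (i : lhom K P) (p : lhom P M)
    (i' : lhom K' P') (q : lhom P' T) (u : lhom M T) (v : lhom T M) :
  projective P -> projective P' -> short_exact i p -> short_exact i' q ->
  stably_zero (hcomp v u - hid M) ->
  exists (u0 : lhom K K') (v0 : lhom K' K),
    stably_zero (hcomp v0 u0 - hid K) /\
    forall Y (f : lhom K Y),
      (exists G : lhom P' Y, forall k, G (i' k) = hcomp f v0 k) ->
      exists F : lhom P Y, forall k, F (i k) = f k.
Proof.
move=> pP pP' ex ex' vu; have [ii ip ps] := ex; have [ii' iq qs] := ex'.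
have [U UE] := pP _ _ q (hcomp u p) qs; have [V VE] := pP' _ _ p (hcomp v q) ps.
have [k|u0 u0E] := lift_mono (i := i') (g := hcomp U i) ii'.
  apply/iq; rewrite /= UE /=; have -> : p (i k) = 0 by apply/ip; exists k.
  exact: linear0.
have [k|v0 v0E] := lift_mono (i := i) (g := hcomp V i') ii.
  apply/ip; rewrite /= VE /=; have -> : q (i' k) = 0 by apply/iq; exists k.
  exact: linear0.
have pF x : p ((hcomp V U - hid P) x) = (hcomp v u - hid M) (p x).
  by rewrite linearB /= VE /= UE.
have iF k : i ((hcomp v0 u0 - hid K) k) = (hcomp V U - hid P) (i k).
  by rewrite linearB /= v0E /= u0E.
exists u0, v0; split; first exact: (syzygy_stably_zero ex ex pP pF iF vu).
have [w wE] := syzygy_factor ex ex pF iF vu.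
move=> Y f [G GE]; exists (hcomp G U - hcomp f w) => k.
rewrite /= -[w (i k)]/(hcomp w i k) -wE -[U (i k)]/(hcomp U i k) -u0E GE /=.
by rewrite linearB subKr.
Qed.

Lemma transpose_retract_syzygy K P M (i : lhom K P) (p : lhom P M) :
  transpose_retract M -> fingen P -> projective P -> short_exact i p ->
  transpose_retract K.
Proof.
move=> [X [T [u [v [CX XT vu]]]]] fP pP ex.
have [X1 [K' [P' [i' [q [[CX1 X1K] fP' pP' ex' _]]]]]] := transpose_syzygy CX XT.
have [u0 [v0 [v0u0 _]]] := retract_syzygy pP pP' ex ex' vu.
by exists X1, K', u0, v0.
Qed.

Lemma transpose_retract_ext K P M (i : lhom K P) (p : lhom P M)
    (f : lhom K (R^o : lmodType R)) :
  transpose_retract M -> fingen P -> projective P -> short_exact i p ->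
  exists F : lhom P (R^o : lmodType R), forall k, F (i k) = f k.
Proof.
move=> [X [T [u [v [CX XT vu]]]]] fP pP ex.
have [X1 [K' [P' [i' [q [_ fP' pP' ex' ext]]]]]] := transpose_syzygy CX XT.
have [u0 [v0 [_ h]]] := retract_syzygy pP pP' ex ex' vu.
by apply: h; exact: ext.
Qed.

End Transposes.

Theorem theorem5p2 (R : comNzRingType) (C : lmodType R -> Prop)
  (noethR : noetherian R) (henselR : henselian_local R)
  (subC : subcategory C)
  (resC : resolving C)
  (frobC : frobenius (mod_stable C))
  (extC : ~ exists X : lmodType R,
      [/\ C X, ~ projective X & Ext1_functor_zero C X]) :
  forall X : lmodType R, C X -> G_category X.
Proof.
have Cext := @hom_to_ring_extends R C noethR henselR subC resC frobC.
have Ccos := all_have_cosyzygies noethR henselR subC resC frobC extC.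
move=> X CX; split; first exact: subcat_fingen CX.
case=> // n _; split.
  apply: (Ext_zero_of_class (D := C)) => // [K P M i p CM fP pP ex|K P M i p f CM fP pP ex].
    exact: (C_kernel noethR subC resC ex (subcat_proj subC fP pP)).
  exact: (Cext _ _ _ i p).
move=> T XT; apply: (Ext_zero_of_class (D := transpose_retract C)).
- by move=> K P M i p; exact: transpose_retract_syzygy.
- by move=> K P M i p f; exact: transpose_retract_ext.
- exists X, T, (hid T), (hid T); split=> //.
  by apply: stably_zero0 => x; exact: subrr.
Qed.
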